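(* Let $X$ be a scheme such that the category $\mathfrak{Qcoh}(X)$ of quasi-coherent sheaves of $\mathcal{O}_X$-modules is a locally finitely presented category. Then every categorical pure short exact sequence in $\mathfrak{Qcoh}(X)$ is pure exact; that is, $\mathbf{Pure_{fp}} \subseteq \mathbf{Pure}$.
   Context: An object $A$ of an additive category $\mathcal{A}$ with direct limits is finitely presented if $\mathrm{Hom}_{\mathcal{A}}(A,-)$ preserves direct limits. $\mathcal{A}$ is locally finitely presented if the skeleton of its subcategory of finitely presented objects is small and every object is a direct limit of finitely presented objects. A short exact sequence $0\to \mathscr{F}\to\mathscr{G}\to\mathscr{T}\to 0$ in $\mathfrak{Qcoh}(X)$ is categorical pure (fp-pure) if $\mathrm{Hom}(\mathscr{H},-)$ leaves it exact for every finitely presented object $\mathscr{H}$ of $\mathfrak{Qcoh}(X)$; $\mathbf{Pure_{fp}}$ is the class of such sequences. An exact sequence $0\to\mathscr{F}\to\mathscr{G}$ of $\mathcal{O}_X$-modules is pure exact if for every $\mathcal{O}_X$-module $\mathscr{M}$ (not necessarily quasi-coherent) the induced sequence $0\to\mathscr{M}\otimes\mathscr{F}\to\mathscr{M}\otimes\mathscr{G}$ is exact (tensor product of sheaves of $\mathcal{O}_X$-modules). A short exact sequence in $\mathfrak{Qcoh}(X)$ is pure exact if its monomorphism is pure exact in this sense; $\mathbf{Pure}$ is the class of such sequences in $\mathfrak{Qcoh}(X)$. *)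

(* Defs.v *)
From HB Require Import structures.
From mathcomp Require Import all_boot all_order all_algebra generic_quotient.
From mathcomp Require Import boolp classical_sets topology.

Set Implicit Arguments.
Unset Strict Implicit.
Unset Printing Implicit Defensive.
Import GRing.Theory.
Local Open Scope ring_scope.
Local Open Scope classical_set_scope.
Local Open Scope quotient_scope.
#[local] Obligation Tactic := idtac.

Record opens (X : topologicalType) := Opens {
  oset :> set X;
  oset_open : open oset }.

Definition opensI (X : topologicalType) (U V : opens X) : opens X :=
  Opens (openI (oset_open U) (oset_open V)).

(* Unique gluing along an arbitrary open cover, given as a set [C] of open
   subsets of [U].  A family agrees on the overlaps when any two members have
   the same restriction to every open set contained in both domains. *)
Definition sheaf_axiom (X : topologicalType) (S : opens X -> Type)
    (res : forall U V : opens X, V `<=` U -> S U -> S V) : Prop :=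
  forall (U : opens X) (C : set (opens X)) (CU : forall V, C V -> V `<=` U),
    (forall x, oset U x -> exists2 V, C V & oset V x) ->
  forall s : (forall V, C V -> S V),
    (forall V V' (c : C V) (c' : C V') (W : opens X) (WV : W `<=` V) (WV' : W `<=` V'),
        res V W WV (s V c) = res V' W WV' (s V' c')) ->
  exists! t : S U, forall V (c : C V), res U V (CU V c) t = s V c.

(* Sections over the empty open set form the zero ring, hence [comPzRingType].
   In [osec_id] and [osec_comp] (and in [pres_id], [pres_comp] below) all
   inclusion proofs are quantified over, so that restriction maps do not depend
   on them. *)
Record ringed_space := RingedSpace {
  space :> topologicalType;
  osec : opens space -> comPzRingType;
  ores : forall U V : opens space, V `<=` U -> {rmorphism osec U -> osec V};
  ores_id : forall (U : opens space) (UU : U `<=` U) a, ores UU a = a;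
  ores_comp : forall (U V W : opens space)
      (VU : V `<=` U) (WV : W `<=` V) (WU : W `<=` U) a,
      ores WV (ores VU a) = ores WU a;
  osec_sheaf : sheaf_axiom (fun U V VU => ores VU : osec U -> osec V) }.

Record pmod (X : ringed_space) := PMod {
  psec :> forall U : opens X, lmodType (osec U);
  pres : forall U V : opens X, V `<=` U -> psec U -> psec V;
  presD : forall (U V : opens X) (VU : V `<=` U) s t,
      pres VU (s + t) = pres VU s + pres VU t;
  presZ : forall (U V : opens X) (VU : V `<=` U) a s,
      pres VU (a *: s) = ores VU a *: pres VU s;
  pres_id : forall (U : opens X) (UU : U `<=` U) s, pres UU s = s;
  pres_comp : forall (U V W : opens X)
      (VU : V `<=` U) (WV : W `<=` V) (WU : W `<=` U) s,
      pres WV (pres VU s) = pres WU s }.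
Arguments pres {X} p {U V} VU s.

Record omod (X : ringed_space) := OMod {
  omod_pmod :> pmod X;
  omod_sheaf : sheaf_axiom (fun U V VU => pres omod_pmod VU) }.

Record pmor (X : ringed_space) (F G : pmod X) := PMor {
  pmor_fun :> forall U : opens X, F U -> G U;
  pmor_linear : forall U, linear (@pmor_fun U);
  pmor_res : forall (U V : opens X) (VU : V `<=` U) s,
      @pmor_fun V (pres F VU s) = pres G VU (@pmor_fun U s) }.
Arguments pmor_fun {X F G} p U s.
Arguments pmor_linear {X F G} p U a s t : rename.

Section PresheafTheory.
Variable X : ringed_space.
Implicit Types (P F G H : pmod X) (U V W : opens X).

Lemma pres_irr P U V (h h' : V `<=` U) s : pres P h s = pres P h' s.
Proof. by rewrite -[LHS](pres_id (@subset_refl _ V)) (pres_comp _ _ h'). Qed.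

Lemma pres0 P U V (VU : V `<=` U) : pres P VU 0 = 0.
Proof.
by apply: (@addrI _ (pres P VU 0)); rewrite -presD !addr0.
Qed.

Lemma presN P U V (VU : V `<=` U) s : pres P VU (- s) = - pres P VU s.
Proof. by apply: (@addrI _ (pres P VU s)); rewrite -presD !subrr pres0. Qed.

Lemma pmorD F G (f : pmor F G) U s t : f U (s + t) = f U s + f U t.
Proof. by have := pmor_linear f U 1 s t; rewrite !scale1r. Qed.

Lemma pmor0 F G (f : pmor F G) U : f U 0 = 0.
Proof. by apply: (@addrI _ (f U 0)); rewrite -pmorD !addr0. Qed.

Lemma pmorZ F G (f : pmor F G) U a s : f U (a *: s) = a *: f U s.
Proof. by have := pmor_linear f U a s 0; rewrite pmor0 !addr0. Qed.

Lemma pmor_eq F G (f g : pmor F G) : (forall U s, f U s = g U s) -> f = g.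
Proof.
case: f g => [f f1 f2] [g g1 g2] /= fg.
have e : f = g.
  by apply: functional_extensionality_dep => U; apply/funext => s; apply: fg.
by subst g; rewrite (Prop_irrelevance f1 g1) (Prop_irrelevance f2 g2).
Qed.

Program Definition pmor_id F : pmor F F := @PMor _ F F (fun U s => s) _ _.
Next Obligation. by []. Qed.
Next Obligation. by []. Qed.

Program Definition pmor_comp F G H (g : pmor G H) (f : pmor F G) : pmor F H :=
  @PMor _ F H (fun U s => g U (f U s)) _ _.
Next Obligation. by move=> F G H g f U a s t /=; rewrite pmorD pmorZ pmorD pmorZ. Qed.
Next Obligation. by move=> F G H g f U V VU s /=; rewrite !pmor_res. Qed.

Program Definition pmor_zero F G : pmor F G := @PMor _ F G (fun U s => 0) _ _.
Next Obligation. by move=> F G U a s t /=; rewrite scaler0 addr0. Qed.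
Next Obligation. by move=> F G U V VU s /=; rewrite pres0. Qed.

Program Definition pmor_opp F G (f : pmor F G) : pmor F G :=
  @PMor _ F G (fun U s => - f U s) _ _.
Next Obligation.
by move=> F G f U a s t /=; rewrite pmorD pmorZ opprD scalerN.
Qed.
Next Obligation. by move=> F G f U V VU s /=; rewrite pmor_res presN. Qed.

Program Definition pmor_add F G (f g : pmor F G) : pmor F G :=
  @PMor _ F G (fun U s => f U s + g U s) _ _.
Next Obligation.
by move=> F G f g U a s t /=; rewrite !pmorD !pmorZ scalerDr addrACA.
Qed.
Next Obligation. by move=> F G f g U V VU s /=; rewrite !pmor_res presD. Qed.

End PresheafTheory.

HB.instance Definition _ (X : ringed_space) (F G : pmod X) :=
  gen_eqMixin (pmor F G).
HB.instance Definition _ (X : ringed_space) (F G : pmod X) :=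
  gen_choiceMixin (pmor F G).

Section PmorZmod.
Variables (X : ringed_space) (F G : pmod X).

Fact pmor_addA : associative (@pmor_add X F G).
Proof. by move=> f g h; apply: pmor_eq => U s /=; rewrite addrA. Qed.
Fact pmor_addC : commutative (@pmor_add X F G).
Proof. by move=> f g; apply: pmor_eq => U s /=; rewrite addrC. Qed.
Fact pmor_add0 : left_id (pmor_zero F G) (@pmor_add X F G).
Proof. by move=> f; apply: pmor_eq => U s /=; rewrite add0r. Qed.
Fact pmor_addN :
  left_inverse (pmor_zero F G) (@pmor_opp X F G) (@pmor_add X F G).
Proof. by move=> f; apply: pmor_eq => U s /=; rewrite addNr. Qed.

HB.instance Definition _ := GRing.isZmodule.Build (pmor F G)
  pmor_addA pmor_addC pmor_add0 pmor_addN.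
End PmorZmod.

Section Sheafification.
Variables (X : ringed_space) (P : pmod X).
Implicit Types (U V W : opens X).

Definition germ_eq (x : X) V (t : P V) V' (t' : P V') : Prop :=
  exists W (WV : W `<=` V) (WV' : W `<=` V'),
    oset W x /\ pres P WV t = pres P WV' t'.

(* A section over [U] of the sheaf associated with [P] is a choice of a germ at
   each point of [U] that locally comes from sections of [P].  It is encoded by
   the set of all sections [t : P V], [V] contained in [U], whose germs are the
   chosen ones. *)
Record shsec U := ShSec {
  shmem : forall V, P V -> Prop;
  shmem_sub : forall V (t : P V), shmem t -> V `<=` U;
  shmem_cover : forall x, oset U x ->
      exists V (t : P V), shmem t /\ oset V x;
  shmem_compat : forall V (t : P V) V' (t' : P V') x,
      shmem t -> shmem t' -> oset V x -> oset V' x -> germ_eq x t t';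
  shmem_sat : forall V (t : P V), V `<=` U ->
      (forall x, oset V x -> exists V' (t' : P V'),
          [/\ shmem t', oset V' x & germ_eq x t t']) ->
      shmem t }.
Arguments shmem {U} s {V} t.

Lemma germ_eq_refl x V (t : P V) : oset V x -> germ_eq x t t.
Proof. by move=> Vx; exists V, (@subset_refl _ V), (@subset_refl _ V). Qed.

Lemma germ_eq_sym x V (t : P V) V' (t' : P V') :
  germ_eq x t t' -> germ_eq x t' t.
Proof. by move=> [W [h [h' [Wx e]]]]; exists W, h', h. Qed.

Lemma germ_eq_trans x V1 (t1 : P V1) V2 (t2 : P V2) V3 (t3 : P V3) :
  germ_eq x t1 t2 -> germ_eq x t2 t3 -> germ_eq x t1 t3.
Proof.
move=> [W [h1 [h2 [Wx e]]]] [W' [h2' [h3 [Wx' e']]]].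
have i : opensI W W' `<=` W by move=> y [].
have i' : opensI W W' `<=` W' by move=> y [].
exists (opensI W W'), (subset_trans i h1), (subset_trans i' h3); split=> //.
rewrite -(pres_comp h1 i) e (pres_comp h2 i (subset_trans i h2)).
by rewrite -(pres_comp h3 i') -e' (pres_comp h2' i' (subset_trans i h2)).
Qed.

Lemma germ_eq_pres x V W (WV : W `<=` V) (t : P V) :
  oset W x -> germ_eq x (pres P WV t) t.
Proof.
by move=> Wx; exists W, (@subset_refl _ W), WV; rewrite pres_id.
Qed.

Lemma shmem_pres U (s : shsec U) V W (WV : W `<=` V) (t : P V) :
  shmem s t -> shmem s (pres P WV t).
Proof.
move=> st; apply: shmem_sat => [|x Wx]; first exact: subset_trans (shmem_sub st).
by exists V, t; split => //; [apply: WV | apply: germ_eq_pres].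
Qed.

Lemma shsec_inj U (s s' : shsec U) :
  (forall V (t : P V), shmem s t <-> shmem s' t) -> s = s'.
Proof.
case: s s' => [m a1 a2 a3 a4] [m' b1 b2 b3 b4] /= e.
have E : m = m'.
  apply: functional_extensionality_dep => V; apply/funext => t.
  exact/propext.
by subst m'; congr ShSec; apply: Prop_irrelevance.
Qed.

Lemma shsec_le U (s s' : shsec U) :
  (forall x, oset U x -> exists V (t : P V),
      [/\ shmem s t, shmem s' t & oset V x]) ->
  forall V (t : P V), shmem s t -> shmem s' t.
Proof.
move=> loc V t st; apply: shmem_sat => [|x Vx]; first exact: shmem_sub st.
have [V' [t' [st' s't' V'x]]] := loc x (shmem_sub st Vx).
by exists V', t'; split => //; apply: shmem_compat st st' Vx V'x.
Qed.

Lemma shsec_eq U (s s' : shsec U) :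
  (forall x, oset U x -> exists V (t : P V),
      [/\ shmem s t, shmem s' t & oset V x]) -> s = s'.
Proof.
move=> loc; apply: shsec_inj => V t; split; first exact: shsec_le.
apply: shsec_le => x /loc [V' [t' [? ? ?]]].
by exists V', t'.
Qed.

(* The section with the same germs as a given compatible covering family. *)
Section Gen.
Variables (U : opens X) (R : forall V, P V -> Prop).
Hypothesis Rsub : forall V (t : P V), R t -> V `<=` U.
Hypothesis Rcover : forall x, oset U x ->
  exists V (t : P V), R t /\ oset V x.
Hypothesis Rcompat : forall V (t : P V) V' (t' : P V') x,
  R t -> R t' -> oset V x -> oset V' x -> germ_eq x t t'.

Definition gen_mem V (t : P V) : Prop :=
  V `<=` U /\ forall x, oset V x -> exists V' (t' : P V'),
      [/\ R t', oset V' x & germ_eq x t t'].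

Lemma gen_memW V (t : P V) : R t -> gen_mem t.
Proof.
move=> Rt; split=> [|x Vx]; first exact: Rsub Rt.
by exists V, t; split => //; apply: germ_eq_refl.
Qed.

Program Definition shgen : shsec U := @ShSec U gen_mem _ _ _ _.
Next Obligation. by move=> V t []. Qed.
Next Obligation.
move=> x /Rcover [V [t [Rt Vx]]]; exists V, t; split=> //; exact: gen_memW.
Qed.
Next Obligation.
move=> V t V' t' x [_ m] [_ m'] /m [W [r [Rr Wx e]]] /m' [W' [r' [Rr' Wx' e']]].
apply: germ_eq_trans e (germ_eq_trans _ (germ_eq_sym e')).
exact: Rcompat.
Qed.
Next Obligation.
move=> V t VU loc /=; split=> // x /loc [V' [t' [[_ m] V'x e]]].
have [W [r [Rr Wx e']]] := m x V'x.
by exists W, r; split => //; apply: germ_eq_trans e e'.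
Qed.

Lemma shgenW V (t : P V) : R t -> shmem shgen t.
Proof. exact: gen_memW. Qed.
End Gen.

Lemma shmem_common U (s s' : shsec U) x : oset U x ->
  exists V (t t' : P V), [/\ shmem s t, shmem s' t' & oset V x].
Proof.
move=> Ux.
have [V [t [st Vx]]] := shmem_cover s Ux.
have [V' [t' [st' V'x]]] := shmem_cover s' Ux.
have i : opensI V V' `<=` V by move=> y [].
have i' : opensI V V' `<=` V' by move=> y [].
exists (opensI V V'), (pres P i t), (pres P i' t').
by split => //; apply: shmem_pres.
Qed.

Lemma germ_eqD x V (t1 t2 : P V) V' (t1' t2' : P V') :
  germ_eq x t1 t1' -> germ_eq x t2 t2' -> germ_eq x (t1 + t2) (t1' + t2').
Proof.
move=> [W [h1 [h2 [Wx e]]]] [W' [h1' [h2' [Wx' e']]]].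
have i : opensI W W' `<=` W by move=> y [].
have i' : opensI W W' `<=` W' by move=> y [].
exists (opensI W W'), (subset_trans i h1), (subset_trans i h2); split=> //.
rewrite !presD; congr (_ + _).
  by rewrite -(pres_comp h1 i) e (pres_comp h2 i (subset_trans i h2)).
rewrite -(pres_comp h1' i' (subset_trans i h1)) e'.
by rewrite (pres_comp h2' i' (subset_trans i h2)).
Qed.

Lemma germ_eqN x V (t : P V) V' (t' : P V') :
  germ_eq x t t' -> germ_eq x (- t) (- t').
Proof.
by move=> [W [h [h' [Wx e]]]]; exists W, h, h'; split; rewrite // !presN e.
Qed.

Lemma germ_eqZ U (a : osec U) x V (t : P V) V' (t' : P V')
    (VU : V `<=` U) (V'U : V' `<=` U) :
  germ_eq x t t' -> germ_eq x (ores VU a *: t) (ores V'U a *: t').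
Proof.
move=> [W [h [h' [Wx e]]]]; exists W, h, h'; split; rewrite // !presZ e.
by rewrite !(ores_comp _ _ (subset_trans h VU)).
Qed.

Program Definition sh_zero U : shsec U :=
  @shgen U (fun V t => V `<=` U /\ t = 0) _ _ _.
Next Obligation. by move=> U V t []. Qed.
Next Obligation. by move=> U x Ux /=; exists U, 0; split=> //; split. Qed.
Next Obligation.
move=> U V t V' t' x [_ ->] [_ ->] Vx V'x.
have i : opensI V V' `<=` V by move=> y [].
have i' : opensI V V' `<=` V' by move=> y [].
by exists (opensI V V'), i, i'; rewrite !pres0.
Qed.

Program Definition sh_opp U (s : shsec U) : shsec U :=
  @shgen U (fun V t => shmem s (- t)) _ _ _.
Next Obligation. by move=> U s V t /shmem_sub. Qed.
Next Obligation.
move=> U s x /(shmem_cover s)[V [t [st Vx]]].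
by exists V, (- t); rewrite opprK.
Qed.
Next Obligation.
move=> U s V t V' t' x st st' Vx V'x /=; rewrite -[t]opprK -[t']opprK.
exact: germ_eqN (shmem_compat st st' Vx V'x).
Qed.

Program Definition sh_add U (s1 s2 : shsec U) : shsec U :=
  @shgen U (fun V t => exists t1 t2,
    [/\ shmem s1 t1, shmem s2 t2 & t = t1 + t2]) _ _ _.
Next Obligation. by move=> U s1 s2 V t [t1 [t2 [/shmem_sub]]]. Qed.
Next Obligation.
move=> U s1 s2 x /(shmem_common s1 s2)[V [t1 [t2 [st1 st2 Vx]]]].
by exists V, (t1 + t2); split => //; exists t1, t2.
Qed.
Next Obligation.
move=> U s1 s2 V t V' t' x [t1 [t2 [m1 m2 ->]]] [t1' [t2' [m1' m2' ->]]] Vx V'x.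
apply: germ_eqD; [exact: shmem_compat m1 m1' Vx V'x | ].
exact: shmem_compat m2 m2' Vx V'x.
Qed.

Program Definition sh_scale U (a : osec U) (s : shsec U) : shsec U :=
  @shgen U (fun V t => exists (VU : V `<=` U) t',
    shmem s t' /\ t = ores VU a *: t') _ _ _.
Next Obligation. by move=> U a s V t []. Qed.
Next Obligation.
move=> U a s x /(shmem_cover s)[V [t [st Vx]]].
by exists V, (ores (shmem_sub st) a *: t); split => //; exists (shmem_sub st), t.
Qed.
Next Obligation.
move=> U a s V t V' t' x [VU [r [sr ->]]] [VU' [r' [sr' ->]]] Vx V'x.
exact: germ_eqZ (shmem_compat sr sr' Vx V'x).
Qed.

Program Definition sh_res U W (WU : W `<=` U) (s : shsec U) : shsec W :=
  @shgen W (fun V t => V `<=` W /\ shmem s t) _ _ _.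
Next Obligation. by move=> U W WU s V t []. Qed.
Next Obligation.
move=> U W WU s x Wx /=; have [V [t [st Vx]]] := shmem_cover s (WU x Wx).
have i : opensI V W `<=` V by move=> y [].
exists (opensI V W), (pres P i t); split=> //.
by split; [move=> y [] | apply: shmem_pres].
Qed.
Next Obligation.
by move=> U W WU s V t V' t' x [_ m] [_ m'] Vx V'x; exact: shmem_compat m m' Vx V'x.
Qed.

Lemma shmem0 U V : V `<=` U -> shmem (sh_zero U) (0 : P V).
Proof. by move=> VU; apply: shgenW. Qed.

Lemma shmemN U (s : shsec U) V (t : P V) : shmem s t -> shmem (sh_opp s) (- t).
Proof. by move=> st; apply: shgenW; rewrite opprK. Qed.

Lemma shmemD U (s s' : shsec U) V (t t' : P V) :
  shmem s t -> shmem s' t' -> shmem (sh_add s s') (t + t').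
Proof. by move=> st st'; apply: shgenW; exists t, t'. Qed.

Lemma shmemZ U (a : osec U) (s : shsec U) V (VU : V `<=` U) (t : P V) :
  shmem s t -> shmem (sh_scale a s) (ores VU a *: t).
Proof. by move=> st; apply: shgenW; exists VU, t. Qed.

Lemma shmem_res U W (WU : W `<=` U) (s : shsec U) V (t : P V) :
  V `<=` W -> shmem s t -> shmem (sh_res WU s) t.
Proof. by move=> VW st; apply: shgenW. Qed.

Lemma shmem_resE U W (WU : W `<=` U) (s : shsec U) V (t : P V) :
  shmem (sh_res WU s) t <-> V `<=` W /\ shmem s t.
Proof.
split=> [m|[]]; last exact: shmem_res.
split; first exact: shmem_sub m.
case: m => VW m; apply: shmem_sat => [|x /m [V' [t' [[_ st'] V'x e]]]].
  exact: subset_trans VW WU.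
by exists V', t'.
Qed.

End Sheafification.
Arguments shmem {X P U} s {V} t.

HB.instance Definition _ (X : ringed_space) (P : pmod X) (U : opens X) :=
  gen_eqMixin (shsec P U).
HB.instance Definition _ (X : ringed_space) (P : pmod X) (U : opens X) :=
  gen_choiceMixin (shsec P U).

Section ShLmod.
Variables (X : ringed_space) (P : pmod X) (U : opens X).
Local Notation add := (@sh_add X P U).
Local Notation scale := (@sh_scale X P U).

Lemma shmem_common3 (s1 s2 s3 : shsec P U) x : oset U x ->
  exists V (t1 t2 t3 : P V),
    [/\ shmem s1 t1, shmem s2 t2, shmem s3 t3 & oset V x].
Proof.
move=> Ux.
have [V [t1 [t2 [m1 m2 Vx]]]] := shmem_common s1 s2 Ux.
have [V' [t3 [m3 V'x]]] := shmem_cover s3 Ux.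
have i : opensI V V' `<=` V by move=> y [].
have i' : opensI V V' `<=` V' by move=> y [].
exists (opensI V V'), (pres P i t1), (pres P i t2), (pres P i' t3).
by split => //; apply: shmem_pres.
Qed.

Fact sh_addA : associative add.
Proof.
move=> s1 s2 s3; apply: shsec_eq => x Ux.
have [V [t1 [t2 [t3 [m1 m2 m3 Vx]]]]] := shmem_common3 s1 s2 s3 Ux.
exists V, (t1 + (t2 + t3)); split=> //; first by apply: shmemD => //; apply: shmemD.
by rewrite addrA; apply: shmemD => //; apply: shmemD.
Qed.

Fact sh_addC : commutative add.
Proof.
move=> s1 s2; apply: shsec_eq => x Ux.
have [V [t1 [t2 [m1 m2 Vx]]]] := shmem_common s1 s2 Ux.
exists V, (t1 + t2); split=> //; first exact: shmemD.
by rewrite addrC; apply: shmemD.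
Qed.

Fact sh_add0 : left_id (sh_zero P U) add.
Proof.
move=> s; apply: shsec_eq => x Ux.
have [V [t [m Vx]]] := shmem_cover s Ux.
exists V, (0 + t); split=> //; last by rewrite add0r.
by apply: shmemD => //; apply: shmem0; exact: shmem_sub m.
Qed.

Fact sh_addN : left_inverse (sh_zero P U) (@sh_opp X P U) add.
Proof.
move=> s; apply: shsec_eq => x Ux.
have [V [t [m Vx]]] := shmem_cover s Ux.
exists V, (- t + t); split=> //; first by apply: shmemD => //; apply: shmemN.
by rewrite addNr; apply: shmem0; exact: shmem_sub m.
Qed.

HB.instance Definition _ := GRing.isZmodule.Build (shsec P U)
  sh_addA sh_addC sh_add0 sh_addN.

Fact sh_scaleA a b s : scale a (scale b s) = scale (a * b) s.
Proof.
apply: shsec_eq => x Ux.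
have [V [t [m Vx]]] := shmem_cover s Ux.
have VU := shmem_sub m.
exists V, (ores VU a *: (ores VU b *: t)); split=> //.
  by apply: shmemZ; apply: shmemZ.
by rewrite scalerA -rmorphM; apply: shmemZ.
Qed.

Fact sh_scale1 : left_id 1 scale.
Proof.
move=> s; apply: shsec_eq => x Ux.
have [V [t [m Vx]]] := shmem_cover s Ux.
have VU := shmem_sub m.
exists V, (ores VU 1 *: t); split=> //; first exact: shmemZ.
by rewrite rmorph1 scale1r.
Qed.

Fact sh_scaleDr : right_distributive scale +%R.
Proof.
move=> a s1 s2; apply: shsec_eq => x Ux.
have [V [t1 [t2 [m1 m2 Vx]]]] := shmem_common s1 s2 Ux.
have VU := shmem_sub m1.
exists V, (ores VU a *: (t1 + t2)); split=> //.
  by apply: shmemZ; apply: shmemD.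
by rewrite scalerDr; apply: shmemD; apply: shmemZ.
Qed.

Fact sh_scaleDl s : {morph scale^~ s : a b / a + b}.
Proof.
move=> a b; apply: shsec_eq => x Ux.
have [V [t [m Vx]]] := shmem_cover s Ux.
have VU := shmem_sub m.
exists V, (ores VU (a + b) *: t); split=> //; first exact: shmemZ.
by rewrite rmorphD scalerDl; apply: shmemD; apply: shmemZ.
Qed.

HB.instance Definition _ := GRing.Zmodule_isLmodule.Build (osec U) (shsec P U)
  sh_scaleA sh_scale1 sh_scaleDr sh_scaleDl.
End ShLmod.

Section SheafifyMod.
Variables (X : ringed_space) (P : pmod X).

Program Definition sh_pmod : pmod X :=
  @PMod X (fun U => shsec P U) (@sh_res X P) _ _ _ _.
Next Obligation.
move=> U V VU s t /=; apply: shsec_eq => x Vx.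
have [W [t1 [t2 [m1 m2 Wx]]]] := shmem_common (sh_res VU s) (sh_res VU t) Vx.
exists W, (t1 + t2); split=> //; last exact: shmemD.
case/shmem_resE: m1 => WV m1; case/shmem_resE: m2 => _ m2.
by apply: shmem_res => //; apply: shmemD.
Qed.
Next Obligation.
move=> U V VU a s /=; apply: shsec_eq => x Vx.
have [W [t [m Wx]]] := shmem_cover (sh_res VU s) Vx.
have WV := shmem_sub m.
exists W, (ores WV (ores VU a) *: t); split=> //; last exact: shmemZ.
case/shmem_resE: m => _ m.
rewrite (ores_comp VU WV (subset_trans WV VU)).
by apply: shmem_res => //; apply: shmemZ.
Qed.
Next Obligation.
move=> U UU s /=; apply: shsec_inj => V t; rewrite shmem_resE.
by split=> [[]|m] //; split=> //; exact: shmem_sub m.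
Qed.
Next Obligation.
move=> U V W VU WV WU s /=; apply: shsec_inj => V' t; rewrite !shmem_resE.
split=> [[? [? ?]]|[? ?]] //; do 2?split=> //.
exact: subset_trans WV.
Qed.

Lemma sh_pmod_sheaf : sheaf_axiom (fun U V VU => pres sh_pmod VU).
Proof.
move=> U C CU cov s agree.
pose R V (t : P V) := exists V' (c : C V'), shmem (s V' c) t.
have Rsub V (t : P V) : R V t -> V `<=` U.
  by move=> [V' [c /shmem_sub VV']]; apply: subset_trans VV' (CU _ c).
have Rcov x : oset U x -> exists V (t : P V), R V t /\ oset V x.
  move=> /cov [V' c V'x]; have [V [t [m Vx]]] := shmem_cover (s V' c) V'x.
  by exists V, t; split=> //; exists V', c.
have Rcompat V (t : P V) V' (t' : P V') x :
    R V t -> R V' t' -> oset V x -> oset V' x -> germ_eq x t t'.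
  move=> [W [c m]] [W' [c' m']] Vx V'x.
  pose Z := opensI V V'.
  have ZV : Z `<=` V by move=> y [].
  have ZV' : Z `<=` V' by move=> y [].
  have ZW := subset_trans ZV (shmem_sub m).
  have ZW' := subset_trans ZV' (shmem_sub m').
  have e := agree W W' c c' Z ZW ZW'.
  have n : shmem (sh_res ZW (s W c)) (pres P ZV t).
    by apply: shmem_res => //; apply: shmem_pres.
  have n' : shmem (sh_res ZW (s W c)) (pres P ZV' t').
    rewrite [sh_res _ _]e; apply: shmem_res => //; exact: shmem_pres.
  have Zx : oset Z x by split.
  apply: germ_eq_trans (germ_eq_sym (germ_eq_pres ZV t Zx)) _.
  apply: germ_eq_trans (germ_eq_pres ZV' t' Zx).
  exact: (shmem_compat n n' Zx Zx).
exists (shgen Rsub Rcov Rcompat); split=> [V c | s' s'P].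
  apply: shsec_eq => x Vx; have [W [t [m Wx]]] := shmem_cover (s V c) Vx.
  exists W, t; split=> //; apply: shmem_res; first exact: shmem_sub m.
  by apply: shgenW; exists V, c.
apply: shsec_eq => x /cov [V c Vx].
have [W [t [m Wx]]] := shmem_cover (s V c) Vx.
exists W, t; split=> //; first by apply: shgenW; exists V, c.
by move: m; rewrite -(s'P V c) => /shmem_resE [].
Qed.

Definition sheafify : omod X := OMod sh_pmod_sheaf.

Program Definition sh_unit_fun U (t : P U) : shsec P U :=
  @shgen X P U (fun V t' => exists VU : V `<=` U, t' = pres P VU t) _ _ _.
Next Obligation. by move=> U t V t' []. Qed.
Next Obligation.
move=> U t x Ux /=; exists U, t; split=> //.
by exists (@subset_refl _ U); rewrite pres_id.
Qed.
Next Obligation.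
move=> U t V r V' r' x [VU ->] [V'U ->] Vx V'x.
apply: germ_eq_trans (germ_eq_pres VU t Vx) (germ_eq_sym _).
exact: germ_eq_pres.
Qed.

Lemma shmem_unit (U : opens X) (t : P U) (V : opens X) (VU : V `<=` U) :
  shmem (sh_unit_fun t) (pres P VU t).
Proof. by apply: shgenW; exists VU. Qed.

Program Definition sh_unit : pmor P sh_pmod := @PMor X P sh_pmod sh_unit_fun _ _.
Next Obligation.
move=> U a s t /=; apply: shsec_eq => x Ux.
pose UU := @subset_refl _ U.
exists U, (pres P UU (a *: s + t)); split=> //; first exact: shmem_unit.
rewrite presD presZ; apply: (@shmemD X P U); last exact: shmem_unit.
by apply: (@shmemZ X P U); exact: shmem_unit.
Qed.
Next Obligation.
move=> U V VU s /=; apply: shsec_eq => x Vx.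
pose VV := @subset_refl _ V.
exists V, (pres P VV (pres P VU s)); split=> //; first exact: shmem_unit.
rewrite pres_id; apply: shmem_res => //; exact: shmem_unit.
Qed.
End SheafifyMod.

Lemma omod_sep (X : ringed_space) (G : omod X) (U : opens X) (s t : G U) :
  (forall x, oset U x -> exists (V : opens X) (VU : V `<=` U),
      oset V x /\ pres G VU s = pres G VU t) -> s = t.
Proof.
move=> loc.
pose C (V : opens X) := exists VU : V `<=` U, pres G VU s = pres G VU t.
have CU V : C V -> V `<=` U by case.
have cov x : oset U x -> exists2 V, C V & oset V x.
  by move=> /loc [V [VU [Vx e]]]; exists V => //; exists VU.
have agree V V' (c : C V) (c' : C V') (W : opens X) (WV : W `<=` V)
    (WV' : W `<=` V') :
    pres G WV (pres G (CU V c) s) = pres G WV' (pres G (CU V' c') s).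
  have WU := subset_trans WV (CU V c).
  by rewrite (pres_comp _ _ WU) (pres_comp _ _ WU).
have [r [_ ru]] := omod_sheaf CU cov agree.
rewrite -(ru s) // -(ru t) // => V c; have [VU e] : C V := c.
by rewrite !(pres_irr (CU V c) VU).
Qed.

Section SheafifyLift.
Variables (X : ringed_space) (P : pmod X) (G : omod X) (f : pmor P G).

Lemma germ_eq_lift (x : X) (V V' : opens X) (t : P V) (t' : P V') :
  germ_eq x t t' -> exists (W : opens X) (WV : W `<=` V) (WV' : W `<=` V'),
    oset W x /\ pres G WV (f V t) = pres G WV' (f V' t').
Proof.
by move=> [W [h [h' [Wx e]]]]; exists W, h, h'; split=> //; rewrite -!pmor_res e.
Qed.

Definition is_lift (U : opens X) (s : shsec P U) (y : G U) : Prop :=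
  forall V (r : P V) (VU : V `<=` U), shmem s r -> pres G VU y = f V r.

Lemma lift_unique (U : opens X) (s : shsec P U) (y y' : G U) :
  is_lift s y -> is_lift s y' -> y = y'.
Proof.
move=> h h'; apply: omod_sep => x /(shmem_cover s) [V [r [m Vx]]].
exists V, (shmem_sub m); split=> //.
by rewrite (h V r _ m) (h' V r _ m).
Qed.

Lemma lift_loc (U : opens X) (s : shsec P U) (y : G U) :
  (forall x, oset U x -> exists (V : opens X) (VU : V `<=` U) (r : P V),
      [/\ shmem s r, oset V x & pres G VU y = f V r]) -> is_lift s y.
Proof.
move=> loc V r VU m; apply: omod_sep => x Vx.
have [V' [V'U [r' [m' V'x e]]]] := loc x (VU x Vx).
have [W [h [h' [Wx eW]]]] := germ_eq_lift (shmem_compat m m' Vx V'x).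
exists W, h; split=> //.
rewrite (pres_comp VU h (subset_trans h VU)) eW -e.
by rewrite (pres_comp V'U h' (subset_trans h VU)).
Qed.

Lemma lift_exists (U : opens X) (s : shsec P U) : exists y : G U, is_lift s y.
Proof.
pose C (V : opens X) := exists r : P V, shmem s r.
have CU V : C V -> V `<=` U by move=> [r /shmem_sub].
have cov x : oset U x -> exists2 V, C V & oset V x.
  by move=> /(shmem_cover s) [V [r [m Vx]]]; exists V => //; exists r.
pose fam V (c : C V) : G V := f V (sval (cid c)).
have agree V V' (c : C V) (c' : C V') (W : opens X) (WV : W `<=` V)
    (WV' : W `<=` V') : pres G WV (fam V c) = pres G WV' (fam V' c').
  rewrite /fam; case: (cid c) => r m /=; case: (cid c') => r' m' /=.
  apply: omod_sep => x Wx.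
  have [Z [h [h' [Zx e]]]] :=
    germ_eq_lift (shmem_compat m m' (WV x Wx) (WV' x Wx)).
  have i : opensI W Z `<=` W by move=> y [].
  have i' : opensI W Z `<=` Z by move=> y [].
  exists (opensI W Z), i; split; first by split.
  rewrite (pres_comp WV i (subset_trans i' h)) -(pres_comp h i') e.
  by rewrite (pres_comp WV' i (subset_trans i' h'))
    (pres_comp h' i' (subset_trans i' h')).
have [y [yP _]] := omod_sheaf CU cov agree.
exists y; apply: lift_loc => x /cov [V c Vx].
exists V, (CU V c), (sval (cid c)); split=> //.
exact: (svalP (cid c)).
Qed.

Definition lift_fun (U : opens X) (s : sheafify P U) : G U :=
  sval (cid (lift_exists s)).

Lemma lift_funP (U : opens X) (s : sheafify P U) : is_lift s (lift_fun s).
Proof. exact: (svalP (cid (lift_exists s))). Qed.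
Arguments lift_funP {U} s V r VU m : rename.

Program Definition sheafify_lift : pmor (sheafify P) G :=
  @PMor X (sheafify P) G lift_fun _ _.
Next Obligation.
move=> U a s t; apply: (lift_unique (lift_funP (a *: s + t))).
apply: lift_loc => x /(shmem_common s t) [V [r [r' [m m' Vx]]]].
have VU := shmem_sub m.
exists V, VU, (ores VU a *: r + r'); split=> //.
  by apply: (@shmemD X P U) => //; apply: shmemZ.
by rewrite presD presZ (lift_funP s _ _ VU m) (lift_funP t _ _ VU m') pmorD pmorZ.
Qed.
Next Obligation.
move=> U V VU s; apply: (lift_unique (lift_funP (pres (sheafify P) VU s))) => W r WV.
move=> /shmem_resE [_ m].
by rewrite (pres_comp VU WV (subset_trans WV VU)) (lift_funP s _ _ _ m).
Qed.

Theorem sheafify_lift_unique :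
  exists! h : pmor (sheafify P) G, pmor_comp h (sh_unit P) = f.
Proof.
exists sheafify_lift; split=> [|h hf]; apply: pmor_eq => U s /=.
  have := lift_funP _ _ _ (@subset_refl _ U) (shmem_unit s (@subset_refl _ U)).
  by rewrite !pres_id.
apply: (lift_unique (lift_funP s)) => V r VU m.
rewrite -pmor_res -hf /=; congr (h V _); apply: shsec_eq => x Vx.
exists V, r; split=> //; first by apply: shmem_res.
by have := shmem_unit r (@subset_refl _ V); rewrite pres_id.
Qed.
End SheafifyLift.

Section SheafifyMor.
Variables (X : ringed_space) (P Q : pmod X) (f : pmor P Q).

Lemma germ_eq_mor x V (t : P V) V' (t' : P V') :
  germ_eq x t t' -> germ_eq x (f V t) (f V' t').
Proof.
move=> [W [h [h' [Wx e]]]]; exists W, h, h'; split=> //.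
by rewrite -!pmor_res e.
Qed.

Program Definition sheafify_fun U (s : shsec P U) : shsec Q U :=
  @shgen X Q U (fun V t => exists2 t', shmem s t' & t = f V t') _ _ _.
Next Obligation. by move=> U s V t [t' /shmem_sub]. Qed.
Next Obligation.
move=> U s x /(shmem_cover s)[V [t [m Vx]]].
by exists V, (f V t); split=> //; exists t.
Qed.
Next Obligation.
move=> U s V t V' t' x [r m ->] [r' m' ->] Vx V'x.
exact: germ_eq_mor (shmem_compat m m' Vx V'x).
Qed.

Lemma shmem_mor U (s : shsec P U) V (t : P V) :
  shmem s t -> shmem (sheafify_fun s) (f V t).
Proof. by move=> m; apply: shgenW; exists t. Qed.

Program Definition sheafify_mor : pmor (sheafify P) (sheafify Q) :=
  @PMor X (sh_pmod P) (sh_pmod Q) sheafify_fun _ _.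
Next Obligation.
move=> U a s t /=; apply: shsec_eq => x Ux.
have [V [t1 [t2 [m1 m2 Vx]]]] := shmem_common s t Ux.
have VU := shmem_sub m1.
exists V, (f V (ores VU a *: t1 + t2)); split=> //.
  by apply: shmem_mor; apply: (@shmemD X P U) => //; apply: shmemZ.
rewrite pmorD pmorZ; apply: (@shmemD X Q U); last exact: shmem_mor.
by apply: (@shmemZ X Q U); exact: shmem_mor.
Qed.
Next Obligation.
move=> U V VU s /=; apply: shsec_eq => x Vx.
have [W [t [m Wx]]] := shmem_cover (sh_res VU s) Vx.
exists W, (f W t); split=> //; first exact: shmem_mor.
case/shmem_resE: m => WV m.
by apply: shmem_res => //; apply: shmem_mor.
Qed.
End SheafifyMor.

Definition is_bilinear (R : comPzRingType) (M N P : lmodType R)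
    (b : M -> N -> P) : Prop :=
  (forall m, linear (b m)) /\ (forall n, linear (b^~ n)).

Section Tensor.
Variables (R : comPzRingType) (M N : lmodType R).

(* A list [:: (m1, n1); ...; (mk, nk)] stands for m1 (x) n1 + ... + mk (x) nk.
   Two such formal sums are identified when every bilinear map gives them the
   same value; the quotient is characterized by [tensor_lift_unique]. *)
Definition tsum (P : lmodType R) (b : M -> N -> P) (s : seq (M * N)) : P :=
  \sum_(p <- s) b p.1 p.2.

Definition teqv_prop (s t : seq (M * N)) : Prop :=
  forall (P : lmodType R) (b : M -> N -> P),
    is_bilinear b -> tsum b s = tsum b t.

Definition teqv : rel (seq (M * N)) := fun s t => `[< teqv_prop s t >].

Fact teqv_refl : reflexive teqv.
Proof. by move=> s; apply/asboolP. Qed.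
Fact teqv_sym : symmetric teqv.
Proof.
by move=> s t; apply/asboolP/asboolP => e P b bP; rewrite (e P b bP).
Qed.
Fact teqv_trans : transitive teqv.
Proof.
move=> t s u /asboolP e /asboolP e'; apply/asboolP => P b bP.
by rewrite (e P b bP) (e' P b bP).
Qed.

Canonical teqv_equiv := EquivRel teqv teqv_refl teqv_sym teqv_trans.

Definition tensor := {eq_quot teqv}.
HB.instance Definition _ := Choice.on tensor.
HB.instance Definition _ := EqQuotient.on tensor.

Definition tclass (s : seq (M * N)) : tensor :=
  \pi_({eq_quot teqv}) s.
Definition tpure (m : M) (n : N) : tensor := tclass [:: (m, n)].

Lemma tclassP s t : tclass s = tclass t <-> teqv_prop s t.
Proof.
split=> [e|e]; first by apply/asboolP; apply/(@eqmodP _ teqv_equiv).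
by apply/(@eqmodP _ teqv_equiv); apply/asboolP.
Qed.

Lemma tensorW (K : tensor -> Prop) : (forall s, K (tclass s)) -> forall t, K t.
Proof. by move=> h t; rewrite -[t]reprK; apply: h. Qed.

Definition tneg (s : seq (M * N)) := [seq (- p.1, p.2) | p <- s].
Definition tscal (a : R) (s : seq (M * N)) := [seq (a *: p.1, p.2) | p <- s].

Definition tensor_zero : tensor := tclass [::].
Definition tensor_opp (x : tensor) : tensor := tclass (tneg (repr x)).
Definition tensor_add (x y : tensor) : tensor := tclass (repr x ++ repr y).
Definition tensor_scale (a : R) (x : tensor) : tensor :=
  tclass (tscal a (repr x)).

Lemma teqv_repr s : teqv_prop (repr (tclass s)) s.
Proof. by apply/tclassP; rewrite /tclass reprK. Qed.

Lemma bilin0l (P : lmodType R) (b : M -> N -> P) n : is_bilinear b -> b 0 n = 0.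
Proof.
move=> [_ bl]; have := bl n 1 0 0; rewrite !scale1r addr0 => e.
by apply: (@addrI _ (b 0 n)); rewrite -e addr0.
Qed.

Lemma bilinZl (P : lmodType R) (b : M -> N -> P) a m n :
  is_bilinear b -> b (a *: m) n = a *: b m n.
Proof.
by move=> bP; have := bP.2 n a m 0; rewrite bilin0l // !addr0.
Qed.

Lemma tsum_neg (P : lmodType R) (b : M -> N -> P) s :
  is_bilinear b -> tsum b (tneg s) = - tsum b s.
Proof.
move=> bP; rewrite /tsum big_map -sumrN; apply: eq_bigr => p _ /=.
by rewrite -scaleN1r bilinZl // scaleN1r.
Qed.

Lemma tsum_scal (P : lmodType R) (b : M -> N -> P) a s :
  is_bilinear b -> tsum b (tscal a s) = a *: tsum b s.
Proof.
move=> bP; rewrite /tsum big_map scaler_sumr; apply: eq_bigr => p _ /=.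
by rewrite bilinZl.
Qed.

Lemma tsum_cat (P : lmodType R) (b : M -> N -> P) s t :
  tsum b (s ++ t) = tsum b s + tsum b t.
Proof. by rewrite /tsum big_cat. Qed.

Lemma tsum0 (P : lmodType R) (b : M -> N -> P) : tsum b [::] = 0.
Proof. by rewrite /tsum big_nil. Qed.

Lemma tensor_addE s t : tensor_add (tclass s) (tclass t) = tclass (s ++ t).
Proof.
apply/tclassP => P b bP.
by rewrite !tsum_cat (teqv_repr s bP) (teqv_repr t bP).
Qed.

Lemma tensor_oppE s : tensor_opp (tclass s) = tclass (tneg s).
Proof. by apply/tclassP => P b bP; rewrite !tsum_neg // (teqv_repr s bP). Qed.

Lemma tensor_scaleE a s : tensor_scale a (tclass s) = tclass (tscal a s).
Proof. by apply/tclassP => P b bP; rewrite !tsum_scal // (teqv_repr s bP). Qed.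

Fact tensor_addA : associative tensor_add.
Proof.
elim/tensorW => s; elim/tensorW => t; elim/tensorW => u.
by rewrite !tensor_addE catA.
Qed.
Fact tensor_addC : commutative tensor_add.
Proof.
elim/tensorW => s; elim/tensorW => t; rewrite !tensor_addE.
by apply/tclassP => P b bP; rewrite !tsum_cat addrC.
Qed.
Fact tensor_add0 : left_id tensor_zero tensor_add.
Proof. by elim/tensorW => s; rewrite tensor_addE. Qed.
Fact tensor_addN : left_inverse tensor_zero tensor_opp tensor_add.
Proof.
elim/tensorW => s; rewrite tensor_oppE tensor_addE.
by apply/tclassP => P b bP; rewrite tsum_cat tsum_neg // tsum0 addNr.
Qed.

HB.instance Definition _ := GRing.isZmodule.Build tensor
  tensor_addA tensor_addC tensor_add0 tensor_addN.

Fact tensor_scaleA a b x :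
  tensor_scale a (tensor_scale b x) = tensor_scale (a * b) x.
Proof.
elim/tensorW: x => s; rewrite !tensor_scaleE.
by apply/tclassP => P c cP; rewrite !tsum_scal // scalerA.
Qed.
Fact tensor_scale1 : left_id 1 tensor_scale.
Proof.
elim/tensorW => s; rewrite tensor_scaleE.
by apply/tclassP => P c cP; rewrite tsum_scal // scale1r.
Qed.
Fact tensor_scaleDr : right_distributive tensor_scale +%R.
Proof.
move=> a; elim/tensorW => s; elim/tensorW => t.
rewrite [tclass s + _]tensor_addE !tensor_scaleE [RHS]tensor_addE.
by rewrite /tscal map_cat.
Qed.
Fact tensor_scaleDl x : {morph tensor_scale^~ x : a b / a + b}.
Proof.
move=> a b; elim/tensorW: x => s; rewrite !tensor_scaleE [RHS]tensor_addE.
by apply/tclassP => P c cP; rewrite tsum_cat !tsum_scal // scalerDl.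
Qed.

HB.instance Definition _ := GRing.Zmodule_isLmodule.Build R tensor
  tensor_scaleA tensor_scale1 tensor_scaleDr tensor_scaleDl.

Lemma tclass_cat s t : tclass (s ++ t) = tclass s + tclass t.
Proof. by rewrite [RHS]tensor_addE. Qed.

Lemma tclass_scal a s : tclass (tscal a s) = a *: tclass s.
Proof. by rewrite [RHS]tensor_scaleE. Qed.

Lemma tpure_bilinear : is_bilinear tpure.
Proof.
split=> [m a n n' | n a m m'] /=; rewrite /tpure -tclass_scal -tclass_cat;
  apply/tclassP => P b bP; rewrite tsum_cat tsum_scal // /tsum !big_seq1 /=.
- exact: bP.1.
- exact: bP.2.
Qed.

Theorem tensor_lift_unique (P : lmodType R) (b : M -> N -> P) :
  is_bilinear b ->
  exists! h : tensor -> P, linear h /\ forall m n, h (tpure m n) = b m n.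
Proof.
move=> bP.
have hE s : tsum b (repr (tclass s)) = tsum b s by apply: teqv_repr.
exists (fun x => tsum b (repr x)); split.
  split=> [a | m n]; last by rewrite hE /tsum big_seq1.
  elim/tensorW => s; elim/tensorW => t.
  by rewrite -tclass_scal -tclass_cat !hE tsum_cat tsum_scal.
move=> h [hl hb]; apply/funext; elim/tensorW => s; rewrite hE.
have hD x y : h (x + y) = h x + h y by have := hl 1 x y; rewrite !scale1r.
elim: s => [|[m n] s IH]; last first.
  by rewrite -cat1s tclass_cat hD tsum_cat IH hb /tsum big_seq1.
by rewrite tsum0; apply: (@addrI _ (h (tclass [::]))); rewrite -hD addr0 addr0.
Qed.

End Tensor.

Definition restrict_scalars (R S : comPzRingType) (phi : {rmorphism R -> S})
  (P : lmodType S) : Type := P.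

Section RestrictScalars.
Variables (R S : comPzRingType) (phi : {rmorphism R -> S}) (P : lmodType S).

Local Notation rscal := (restrict_scalars phi P).
HB.instance Definition _ := GRing.Zmodule.copy rscal P.

Definition rscale (a : R) (x : rscal) : rscal := (phi a : S) *: (x : P).

Fact rscaleA a b x : rscale a (rscale b x) = rscale (a * b) x.
Proof. by rewrite /rscale scalerA rmorphM. Qed.
Fact rscale1 : left_id 1 rscale.
Proof. by move=> x; rewrite /rscale rmorph1 scale1r. Qed.
Fact rscaleDr : right_distributive rscale +%R.
Proof. by move=> a x y; rewrite /rscale scalerDr. Qed.
Fact rscaleDl x : {morph rscale^~ x : a b / a + b}.
Proof. by move=> a b; rewrite /rscale rmorphD scalerDl. Qed.

HB.instance Definition _ := GRing.Zmodule_isLmodule.Build R rscal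
  rscaleA rscale1 rscaleDr rscaleDl.
End RestrictScalars.

Section TensorMap.
Variables (R S : comPzRingType) (phi : {rmorphism R -> S}).
Variables (M N : lmodType R) (M' N' : lmodType S).
Variables (f : M -> M') (g : N -> N').
Hypothesis fD : {morph f : x y / x + y}.
Hypothesis gD : {morph g : x y / x + y}.
Hypothesis fZ : forall a x, f (a *: x) = phi a *: f x.
Hypothesis gZ : forall a x, g (a *: x) = phi a *: g x.

Definition tmap_seq (s : seq (M * N)) := [seq (f p.1, g p.2) | p <- s].

Definition tensor_map (x : tensor M N) : tensor M' N' :=
  tclass (tmap_seq (repr x)).

Lemma tensor_mapE s : tensor_map (tclass s) = tclass (tmap_seq s).
Proof.
apply/tclassP => P b [b1 b2]; rewrite /tsum !big_map.
pose b' (m : M) (n : N) : restrict_scalars phi P := b (f m) (g n).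
have b'P : is_bilinear b'.
  split=> [m a n n' | n a m m']; rewrite /b'.
  - by rewrite gD gZ; apply: b1.
  - by rewrite fD fZ; apply: b2.
exact: (teqv_repr s b'P).
Qed.

Lemma tensor_mapD : {morph tensor_map : x y / x + y}.
Proof.
elim/tensorW => s; elim/tensorW => t.
by rewrite -tclass_cat !tensor_mapE /tmap_seq map_cat tclass_cat.
Qed.

Lemma tensor_mapZ a x : tensor_map (a *: x) = phi a *: tensor_map x.
Proof.
elim/tensorW: x => s; rewrite -tclass_scal !tensor_mapE -tclass_scal.
rewrite /tmap_seq /tscal -!map_comp; congr tclass; apply: eq_map => p /=.
by rewrite fZ.
Qed.
End TensorMap.

Section TensorSheaf.
Variable X : ringed_space.
Implicit Types M F G : pmod X.

Definition ptensor_res M F (U V : opens X) (VU : V `<=` U) :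
    tensor (M U) (F U) -> tensor (M V) (F V) :=
  tensor_map (pres M VU) (pres F VU).

Lemma ptensor_resE M F (U V : opens X) (VU : V `<=` U) s :
  ptensor_res VU (tclass s) =
  tclass [seq (pres M VU p.1, pres F VU p.2) | p <- s].
Proof.
exact: (@tensor_mapE _ _ (ores VU) _ _ _ _ _ _ (presD VU) (presD VU)
  (presZ VU) (presZ VU)).
Qed.

Program Definition ptensor M F : pmod X :=
  @PMod X (fun U => tensor (M U) (F U)) (@ptensor_res M F) _ _ _ _.
Next Obligation.
move=> M F U V VU /=.
exact: (@tensor_mapD _ _ (ores VU) _ _ _ _ _ _ (presD VU) (presD VU)
  (presZ VU) (presZ VU)).
Qed.
Next Obligation.
move=> M F U V VU /=.
exact: (@tensor_mapZ _ _ (ores VU) _ _ _ _ _ _ (presD VU) (presD VU)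
  (presZ VU) (presZ VU)).
Qed.
Next Obligation.
move=> M F U UU /=; elim/tensorW => s; rewrite ptensor_resE; congr tclass.
by rewrite -[RHS]map_id; apply: eq_map => -[m n] /=; rewrite !pres_id.
Qed.
Next Obligation.
move=> M F U V W VU WV WU /=; elim/tensorW => s; rewrite !ptensor_resE.
rewrite -map_comp; congr tclass; apply: eq_map => p /=.
by rewrite !(pres_comp VU WV WU).
Qed.

Lemma ptensor_morE M F G (f : pmor F G) (U : opens X) s :
  tensor_map (fun m : M U => m) (f U) (tclass s) =
  tclass [seq (p.1, f U p.2) | p <- s].
Proof.
by apply: (@tensor_mapE _ _ idfun) => //; [exact: pmorD | exact: pmorZ].
Qed.

Program Definition ptensor_mor M F G (f : pmor F G) :
    pmor (ptensor M F) (ptensor M G) :=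
  @PMor X (ptensor M F) (ptensor M G)
    (fun U => tensor_map (fun m : M U => m) (f U)) _ _.
Next Obligation.
move=> M F G f U a /=; elim/tensorW => s; elim/tensorW => t.
rewrite -tclass_scal -tclass_cat !ptensor_morE -tclass_scal -tclass_cat.
by rewrite map_cat /tscal -!map_comp.
Qed.
Next Obligation.
move=> M F G f U V VU /=; elim/tensorW => s.
rewrite ptensor_resE !ptensor_morE ptensor_resE -!map_comp.
by congr tclass; apply: eq_map => p /=; rewrite pmor_res.
Qed.

Definition otensor (M F : omod X) : omod X := sheafify (ptensor M F).

Definition otensor_mor (M F G : omod X) (f : pmor F G) :
    pmor (otensor M F) (otensor M G) :=
  sheafify_mor (ptensor_mor M f).

End TensorSheaf.

Record prime_ideal (A : comPzRingType) := PrimeIdeal {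
  prime_set :> set A;
  prime0 : prime_set 0;
  primeD : forall a b, prime_set a -> prime_set b -> prime_set (a + b);
  primeM : forall a b, prime_set b -> prime_set (a * b);
  prime1 : ~ prime_set 1;
  prime_mul : forall a b, prime_set (a * b) -> prime_set a \/ prime_set b }.

Definition dopen (A : comPzRingType) (a : A) : set (prime_ideal A) :=
  [set p | ~ prime_set p a].

Definition zariski_open (A : comPzRingType) (S : set (prime_ideal A)) : Prop :=
  forall p, S p -> exists2 a, dopen a p & dopen a `<=` S.

(* [phi : M -> N] exhibits N as the localization of M at the powers of an
   element acting on M by [s] and on N by [t]. *)
Definition is_localization (M N : zmodType) (phi : M -> N)
    (s : M -> M) (t : N -> N) : Prop :=
  [/\ bijective t,
      forall n, exists k m, iter k t n = phi m &
      forall m, phi m = 0 -> exists k, iter k s m = 0].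

(* An isomorphism of ringed spaces between Spec A and the open subspace U of X.
   The structure sheaf of Spec A is the sheaf with value A_a on the basic open
   set D(a), so an isomorphism onto it amounts to a ring morphism A -> O_X(U)
   inducing isomorphisms from A_a to the sections of O_X on the image of D(a). *)
Record affine_chart (X : ringed_space) (U : opens X) := AffineChart {
  chart_ring : comPzRingType;
  chart_pt : prime_ideal chart_ring -> X;
  chart_inj : injective chart_pt;
  chart_range : range chart_pt = U;
  chart_homeo : forall S : set (prime_ideal chart_ring),
      open (chart_pt @` S) <-> zariski_open S;
  chart_map : {rmorphism chart_ring -> osec U};
  chart_loc : forall (a : chart_ring) (V : opens X) (VU : V `<=` U),
      oset V = chart_pt @` dopen a ->
      is_localization (fun b => ores VU (chart_map b))
        ( *%R a) ( *%R (ores VU (chart_map a))) }.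

Record scheme := Scheme {
  scheme_space :> ringed_space;
  scheme_affine : forall x : scheme_space,
      exists (U : opens scheme_space) (_ : affine_chart U), oset U x }.

(* For every affine open U = Spec A and every a in A, F(D(a)) is the
   localization of F(U) at a; equivalently, the restriction of F to every affine
   open U is the sheaf associated with the module F(U). *)
Definition quasi_coherent (X : ringed_space) (F : omod X) : Prop :=
  forall (U : opens X) (c : affine_chart U) (a : chart_ring c)
      (V : opens X) (VU : V `<=` U),
    oset V = @chart_pt _ _ c @` dopen a ->
    is_localization (pres F VU)
      ( *:%R (chart_map c a)) ( *:%R (ores VU (chart_map c a))).

Record qcoh (X : ringed_space) := QCoh {
  qcoh_omod :> omod X;
  qcoh_prop : quasi_coherent qcoh_omod }.

Record preadditive := Preadditive {
  ob :> Type;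
  hom : ob -> ob -> zmodType;
  idm : forall A, hom A A;
  comp : forall A B C, hom B C -> hom A B -> hom A C;
  comp1m : forall A B (f : hom A B), comp (idm B) f = f;
  compm1 : forall A B (f : hom A B), comp f (idm A) = f;
  compA : forall A B C D (h : hom C D) (g : hom B C) (f : hom A B),
      comp h (comp g f) = comp (comp h g) f;
  compDl : forall A B C (g g' : hom B C) (f : hom A B),
      comp (g + g') f = comp g f + comp g' f;
  compDr : forall A B C (g : hom B C) (f f' : hom A B),
      comp g (f + f') = comp g f + comp g f' }.
Arguments hom {p} _ _.
Arguments idm {p} A.
Arguments comp {p A B C} _ _.

(* Small means of the size of the modules of sections of a sheaf; the types
   [omod X] and [qcoh X] live in a strictly larger universe. *)
Notation small_type := Type@{GRing.Lmodule.axioms_.u0}.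

Record directed_set := DirectedSet {
  dcar :> small_type;
  dle : dcar -> dcar -> Prop;
  dle_refl : forall i, dle i i;
  dle_trans : forall i j k, dle i j -> dle j k -> dle i k;
  d_inhabited : inhabited dcar;
  d_directed : forall i j, exists k, dle i k /\ dle j k }.

Record direct_system (C : preadditive) (I : directed_set) := DirectSystem {
  ds_ob :> I -> C;
  ds_map : forall i j, dle i j -> hom (ds_ob i) (ds_ob j);
  ds_id : forall i (ii : dle i i), ds_map ii = idm (ds_ob i);
  ds_comp : forall i j k (ij : dle i j) (jk : dle j k) (ik : dle i k),
      comp (ds_map jk) (ds_map ij) = ds_map ik }.
Arguments ds_map {C I} d {i j} ij.
Arguments ds_comp {C I} d {i j k} ij jk ik.

Record cocone (C : preadditive) (I : directed_set) (D : direct_system C I)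
    (L : C) := Cocone {
  cc_map :> forall i, hom (D i) L;
  cc_comp : forall i j (ij : dle i j), comp (cc_map j) (ds_map D ij) = cc_map i }.

Definition is_direct_limit (C : preadditive) (I : directed_set)
    (D : direct_system C I) (L : C) (c : cocone D L) : Prop :=
  forall (Z : C) (d : cocone D Z),
    exists! h : hom L Z, forall i, comp h (c i) = d i.

Record ab_hom (A B : zmodType) := AbHom {
  ab_fun :> A -> B;
  ab_funD : {morph ab_fun : x y / x + y} }.

Section Ab.
Implicit Types A B : zmodType.

Lemma ab_hom_eq A B (f g : ab_hom A B) : f =1 g -> f = g.
Proof.
case: f g => [f f1] [g g1] /= /funext fg; subst g.
by rewrite (Prop_irrelevance f1 g1).
Qed.

Program Definition ab_zero A B : ab_hom A B := @AbHom A B (fun=> 0) _.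
Next Obligation. by move=> A B x y /=; rewrite addr0. Qed.
Program Definition ab_opp A B (f : ab_hom A B) : ab_hom A B :=
  @AbHom A B (fun x => - f x) _.
Next Obligation. by move=> A B f x y /=; rewrite ab_funD opprD. Qed.
Program Definition ab_add A B (f g : ab_hom A B) : ab_hom A B :=
  @AbHom A B (fun x => f x + g x) _.
Next Obligation. by move=> A B f g x y /=; rewrite !ab_funD addrACA. Qed.
Program Definition ab_id A : ab_hom A A := @AbHom A A (fun x => x) _.
Next Obligation. by []. Qed.
Program Definition ab_comp A B C (g : ab_hom B C) (f : ab_hom A B) :
  ab_hom A C := @AbHom A C (fun x => g (f x)) _.
Next Obligation. by move=> A B C g f x y /=; rewrite !ab_funD. Qed.
End Ab.

HB.instance Definition _ (A B : zmodType) := gen_eqMixin (ab_hom A B).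
HB.instance Definition _ (A B : zmodType) := gen_choiceMixin (ab_hom A B).

Section AbZmod.
Variables A B : zmodType.
Fact ab_addA : associative (@ab_add A B).
Proof. by move=> f g h; apply: ab_hom_eq => x /=; rewrite addrA. Qed.
Fact ab_addC : commutative (@ab_add A B).
Proof. by move=> f g; apply: ab_hom_eq => x /=; rewrite addrC. Qed.
Fact ab_add0 : left_id (ab_zero A B) (@ab_add A B).
Proof. by move=> f; apply: ab_hom_eq => x /=; rewrite add0r. Qed.
Fact ab_addN : left_inverse (ab_zero A B) (@ab_opp A B) (@ab_add A B).
Proof. by move=> f; apply: ab_hom_eq => x /=; rewrite addNr. Qed.
HB.instance Definition _ := GRing.isZmodule.Build (ab_hom A B)
  ab_addA ab_addC ab_add0 ab_addN.
End AbZmod.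

Program Definition Ab : preadditive :=
  @Preadditive zmodType (fun A B => ab_hom A B) ab_id ab_comp _ _ _ _ _.
Next Obligation. by move=> A B f /=; apply: ab_hom_eq. Qed.
Next Obligation. by move=> A B f /=; apply: ab_hom_eq. Qed.
Next Obligation. by move=> A B C D h g f /=; apply: ab_hom_eq. Qed.
Next Obligation. by move=> A B C g g' f /=; apply: ab_hom_eq. Qed.
Next Obligation.
by move=> A B C g f f' /=; apply: ab_hom_eq => x; rewrite /= ab_funD.
Qed.

Section HomFunctor.
Variables (C : preadditive) (A : C).

Definition hom_post (B B' : C) (g : hom B B') : ab_hom (hom A B) (hom A B') :=
  @AbHom (hom A B) (hom A B') (fun f => comp g f) (compDr g).

Variables (I : directed_set) (D : direct_system C I).

Program Definition hom_system : direct_system Ab I :=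
  @DirectSystem Ab I (fun i => hom A (D i))
    (fun i j ij => hom_post (ds_map D ij)) _ _.
Next Obligation.
by move=> i ii /=; apply: ab_hom_eq => f; rewrite /= ds_id comp1m.
Qed.
Next Obligation.
move=> i j k ij jk ik; apply: ab_hom_eq => f.
by rewrite /= compA (ds_comp D ij jk ik).
Qed.

Program Definition hom_cocone (L : C) (c : cocone D L) :
    cocone hom_system (hom A L : Ab) :=
  @Cocone Ab I hom_system (hom A L) (fun i => hom_post (c i)) _.
Next Obligation.
by move=> L c i j ij /=; apply: ab_hom_eq => f; rewrite /= compA cc_comp.
Qed.
End HomFunctor.

Definition finitely_presented (C : preadditive) (A : C) : Prop :=
  forall (I : directed_set) (D : direct_system C I) (L : C) (c : cocone D L),
    is_direct_limit c -> is_direct_limit (hom_cocone A c).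

Definition isomorphic (C : preadditive) (A B : C) : Prop :=
  exists (f : hom A B) (g : hom B A), comp g f = idm A /\ comp f g = idm B.

Definition is_additive (C : preadditive) : Prop :=
  (exists Z : C, idm Z = 0) /\
  (forall A B : C, exists (S : C) (i : hom A S) (j : hom B S)
      (p : hom S A) (q : hom S B),
    [/\ comp p i = idm A, comp q j = idm B, comp p j = 0, comp q i = 0 &
        comp i p + comp j q = idm S]).

Definition has_direct_limits (C : preadditive) : Prop :=
  forall (I : directed_set) (D : direct_system C I),
    exists (L : C) (c : cocone D L), is_direct_limit c.

Definition skeletally_small_fp (C : preadditive) : Prop :=
  exists (S : small_type) (E : S -> C),
    (forall s, finitely_presented (E s)) /\
    (forall A : C, finitely_presented A -> exists s, isomorphic A (E s)).

Definition locally_finitely_presented (C : preadditive) : Prop :=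
  [/\ is_additive C, has_direct_limits C, skeletally_small_fp C &
      forall A : C, exists (I : directed_set) (D : direct_system C I)
          (c : cocone D A),
        (forall i, finitely_presented (D i)) /\ is_direct_limit c].

Program Definition Qcoh (X : ringed_space) : preadditive :=
  @Preadditive (qcoh X) (fun F G => pmor F G) (fun F => pmor_id F)
    (fun F G H => @pmor_comp X F G H) _ _ _ _ _.
Next Obligation. by move=> X F G f /=; apply: pmor_eq. Qed.
Next Obligation. by move=> X F G f /=; apply: pmor_eq. Qed.
Next Obligation. by move=> X F G H K h g f /=; apply: pmor_eq. Qed.
Next Obligation. by move=> X F G H g g' f /=; apply: pmor_eq. Qed.
Next Obligation.
by move=> X F G H g f f' /=; apply: pmor_eq => U s /=; rewrite pmorD.
Qed.

Section Exactness.
Variable X : ringed_space.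

Definition mono_exact (F G : omod X) (f : pmor F G) : Prop :=
  forall U : opens X, injective (f U).

Definition middle_exact (F G T : omod X) (f : pmor F G) (g : pmor G T) : Prop :=
  (forall (U : opens X) (r : F U), g U (f U r) = 0) /\
  (forall (U : opens X) (s : G U), g U s = 0 ->
    forall x, oset U x -> exists (V : opens X) (VU : V `<=` U) (r : F V),
      oset V x /\ f V r = pres G VU s).

Definition epi_exact (G T : omod X) (g : pmor G T) : Prop :=
  forall (U : opens X) (t : T U) x, oset U x ->
    exists (V : opens X) (VU : V `<=` U) (s : G V),
      oset V x /\ g V s = pres T VU t.

End Exactness.

(* Exactness is that of sheaves of modules; the inclusion of Qcoh(X) into the
   category of all O_X-modules preserves and reflects it when X is a scheme. *)
Record short_exact (X : ringed_space) := ShortExact {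
  se_F : Qcoh X;
  se_G : Qcoh X;
  se_T : Qcoh X;
  se_f : hom se_F se_G;
  se_g : hom se_G se_T;
  se_mono : mono_exact se_f;
  se_middle : middle_exact se_f se_g;
  se_epi : epi_exact se_g }.

Definition Pure_fp (X : ringed_space) (e : short_exact X) : Prop :=
  forall H : Qcoh X, finitely_presented H ->
    let F_ := hom_post H (se_f e) in
    let G_ := hom_post H (se_g e) in
    [/\ injective F_,
        forall u, G_ u = 0 <-> exists v, F_ v = u &
        forall w, exists u, G_ u = w].

Definition pure_mono (X : ringed_space) (F G : omod X) (f : pmor F G) : Prop :=
  forall M : omod X, mono_exact (otensor_mor M f).

Definition Pure (X : ringed_space) (e : short_exact X) : Prop :=
  pure_mono (se_f e).

(* Main.v *)
From HB Require Import structures.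
From mathcomp Require Import all_boot all_algebra.
From mathcomp Require Import boolp classical_sets topology.
Require Import Defs.

Set Implicit Arguments.
Unset Strict Implicit.
Unset Printing Implicit Defensive.
Import GRing.Theory.
Local Open Scope ring_scope.
Local Open Scope classical_set_scope.
Local Open Scope quotient_scope.
#[local] Obligation Tactic := idtac.

(* Write T as a direct limit of finitely presented T_i in Qcoh(X).  By purity
   each T_i -> T lifts to s_i : T_i -> G, so the pullback of the sequence along
   T_i -> T splits and is isomorphic to F (+) T_i.  Hence F -> G is, on stalks,
   a direct limit of split monomorphisms F -> F (+) T_i, and M (x) - preserves
   both direct limits and split monomorphisms.

   The main point is that direct limits in Qcoh(X) are computed on stalks: the
   sheaf associated with the presheaf colimit of the T_i is quasi-coherent,
   because basic open subsets of affine charts are quasi-compact and sections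
   over their finite covers glue at a finite stage. *)

(** * Quasi-compactness of basic open sets *)

Section PrimeAvoidance.
Variable A : comPzRingType.

Definition is_ideal (J : set A) : Prop :=
  [/\ J 0, forall a b, J a -> J b -> J (a + b) & forall a b, J b -> J (a * b)].

(** By Zorn's lemma there is an ideal maximal among those that contain [J] and no power of [a];
    maximality makes it prime. *)
Lemma exists_prime (J : set A) (a : A) :
  is_ideal J -> (forall n, ~ J (a ^+ n)) ->
  exists2 p : prime_ideal A, J `<=` p & ~ prime_set p a.
Proof.
move=> idJ Ja.
pose good Y := [/\ is_ideal Y, J `<=` Y & forall n, ~ Y (a ^+ n)].
have goodJ : good J by split.
have [|Y [[Y0|[[Y0 YD YM] JY Ya]] Ymax]] :=
  @Zorn_bigcup A (fun Y => Y = set0 \/ good Y).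
- move=> F Fgood Ftot; have [[Y FY goodY]|nogood] :=
    pselect (exists2 Y, F Y & good Y); last first.
    left; rewrite -subset0 => y [Y FY Yy].
    have [Y0|goodY] := Fgood Y FY; first by rewrite Y0 in Yy.
    by case: nogood; exists Y.
  have goodF Z z : F Z -> Z z -> good Z.
    by move=> FZ Zz; case: (Fgood Z FZ) => // Z0; rewrite Z0 in Zz.
  case: (goodY) => -[Y0 YD YM] JY Ya.
  right; split; first split.
  + by exists Y.
  + move=> b c [Z FZ Zb] [Z' FZ' Z'c].
    have [ZZ'|Z'Z] := Ftot Z Z' FZ FZ'.
      exists Z' => //; have [[_ + _] _ _] := goodF _ _ FZ' Z'c.
      by apply=> //; exact: ZZ'.
    exists Z => //; have [[_ + _] _ _] := goodF _ _ FZ Zb.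
    by apply=> //; exact: Z'Z.
  + move=> b c [Z FZ Zc]; exists Z => //.
    by have [[_ _ ZM] _ _] := goodF _ _ FZ Zc; exact: ZM.
  + by move=> y Jy; exists Y => //; exact: JY.
  + move=> n [Z FZ Zan]; have [_ _ Za] := goodF _ _ FZ Zan.
    exact: Za Zan.
- case: (Ymax J); last by right.
  rewrite Y0 properEneq; split => //; apply/eqP => J0.
  by have [] := idJ; rewrite -J0.
(* By maximality of [Y], the ideal [Y + (b)] contains a power of [a]. *)
have enlarge b : ~ Y b -> exists n y r, Y y /\ a ^+ n = y + r * b.
  move=> Yb; apply: contrapT => none.
  pose Z := [set z | exists y r, Y y /\ z = y + r * b].
  case: (Ymax Z).
    split; last first.
      by move=> /(_ b) ZY; apply/Yb/ZY; exists 0, 1; rewrite add0r mul1r.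
    by move=> y Yy; exists y, 0; rewrite mul0r addr0.
  right; split; first split.
  - by exists 0, 0; rewrite mul0r addr0.
  - move=> _ _ [y [r [Yy ->]]] [y' [r' [Yy' ->]]].
    by exists (y + y'), (r + r'); split; [exact: YD | rewrite mulrDl addrACA].
  - move=> c _ [y [r [Yy ->]]]; exists (c * y), (c * r).
    by split; [exact: YM | rewrite mulrDr mulrA].
  - by move=> y /JY Yy; exists y, 0; rewrite mul0r addr0.
  - by move=> n [y [r [Yy e]]]; apply: none; exists n, y, r.
(* A power of [a] in [Y + (b)] times one in [Y + (c)] lies in [Y + (b * c)], which is [Y]. *)
have Yprime b c : Y (b * c) -> Y b \/ Y c.
  move=> Ybc; apply: contrapT => /not_orP[/enlarge[n [y [r [Yy e]]]]].
  move=> /enlarge[m [y' [r' [Yy' e']]]]; apply: (Ya (n + m)).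
  rewrite exprD e e' mulrDl !mulrDr -!addrA; apply: (YD).
    exact: YM.
  rewrite [y * _]mulrC; apply: (YD); first exact: YM.
  apply: (YD); first exact: YM.
  by rewrite mulrACA; exact: YM.
exists (PrimeIdeal Y0 YD YM (Ya 0) Yprime) => //.
exact: Ya 1.
Qed.

Lemma prime_expr (p : prime_ideal A) a n :
  prime_set p (a ^+ n) -> prime_set p a.
Proof.
elim: n => [/prime1 // | n IH]; rewrite exprS => /prime_mul[] //.
Qed.

Lemma dopenM (a b : A) : dopen (a * b) = dopen a `&` dopen b.
Proof.
apply/seteqP; split=> p; rewrite /dopen /=.
  by move=> pab; split=> h; apply: pab; [rewrite mulrC|]; exact: primeM.
by move=> [pa pb] /prime_mul[].
Qed.

(** The ideal generated by [S] contains a power of [a]: otherwise some prime would contain [S] and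
    miss [a], a point of [dopen a] left uncovered. The finitely many members of [S] in an expression
    of that power already cover. *)
Lemma dopen_quasi_compact (a : A) (S : set A) :
  (forall p, dopen a p -> exists2 b, S b & dopen b p) ->
  exists n (b : 'I_n -> A), (forall i, S (b i)) /\
    forall p, dopen a p -> exists i, dopen (b i) p.
Proof.
move=> cov.
pose J := [set y | exists s : seq (A * A),
  (forall q, q \in s -> S q.2) /\ y = \sum_(q <- s) q.1 * q.2].
have idJ : is_ideal J.
  split.
  - by exists [::]; rewrite big_nil.
  - move=> _ _ [s [sS ->]] [t [tS ->]]; exists (s ++ t).
    split; last by rewrite big_cat.
    by move=> q; rewrite mem_cat => /orP[/sS|/tS].
  - move=> c _ [s [sS ->]]; exists [seq (c * q.1, q.2) | q <- s].
    split; first by move=> _ /mapP[q /sS ? ->].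
    by rewrite big_map mulr_sumr; apply: eq_bigr => q _; rewrite mulrA.
have [m [s [sS am]]] : exists m, J (a ^+ m).
  apply: contrapT => none.
  have [|p Jp pa] := exists_prime (a := a) idJ.
    by move=> n Jan; apply: none; exists n.
  have [b Sb pb] := cov p pa; apply: pb; apply: Jp.
  exists [:: (1, b)]; split; last by rewrite big_seq1 mul1r.
  by move=> q; rewrite inE => /eqP ->.
exists (size s), (fun i => (tnth (in_tuple s) i).2); split.
  by move=> i; apply: sS; exact: mem_tnth.
move=> p pa; apply: contrapT => none; apply: pa; apply: (@prime_expr _ _ m).
rewrite am big_tnth; apply: (big_ind (prime_set p)) => [||i _].
- exact: prime0.
- exact: primeD.
- apply: primeM; apply: contrapT => pb; apply: none; by exists i.
Qed.
End PrimeAvoidance.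

(** * Basic open subsets of an affine chart *)

Section BasicOpens.
Variables (X : ringed_space) (U : opens X) (c : affine_chart U).
Implicit Types (V W : opens X).

Definition is_basic V : Prop :=
  exists a, oset V = @chart_pt _ _ c @` dopen a.

Lemma is_basic_chart : is_basic U.
Proof.
exists 1; rewrite -(chart_range c); apply/seteqP.
split=> x [p _ <-]; exists p => //.
exact: prime1.
Qed.

Lemma is_basicI V W : is_basic V -> is_basic W -> is_basic (opensI V W).
Proof.
move=> [a Va] [b Wb]; exists (a * b); rewrite /= Va Wb dopenM.
apply/seteqP; split=> x; first last.
  by move=> [p [pa pb] <-]; split; exists p.
move=> [[p pa <-] [q qb /chart_inj e]]; exists p => //; split=> //.
by rewrite -e.
Qed.

Lemma basic_open (a : chart_ring c) : open (@chart_pt _ _ c @` dopen a).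
Proof. by apply/chart_homeo => p pa; exists a. Qed.

(* Refining covers to basic opens makes finite subcovers available together
   with their pairwise intersections. *)
Lemma basic_quasi_compact V (C : opens X -> Prop) : is_basic V ->
  (forall W W', W' `<=` W -> C W -> C W') ->
  (forall x, oset V x -> exists W, oset W x /\ C W) ->
  exists n (W : 'I_n -> opens X),
    (forall i, [/\ is_basic (W i), W i `<=` V & C (W i)]) /\
    forall x, oset V x -> exists i, oset (W i) x.
Proof.
move=> [a Va] Csub cov.
pose D b := Opens (@basic_open b).
have [p|n [b [bC bcov]]] :=
    @dopen_quasi_compact _ a [set b | C (D b) /\ D b `<=` V].
  move=> pa; have [|W [Wp CW]] := cov (chart_pt p).
    by rewrite Va; exists p.
  (* The trace of [W] and [V] on the chart is open, so it contains a basic neighbourhood of [p]. *)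
  pose S := [set q | oset W (@chart_pt _ _ c q) /\ oset V (chart_pt q)].
  have Sopen : zariski_open S.
    apply/(@chart_homeo _ _ c S).
    have -> : @chart_pt _ _ c @` S = oset W `&` oset V.
      apply/seteqP; split=> [_ [q [? ?] <-] //|x [Wx Vx]].
      by move: Vx; rewrite Va => -[q qa qx]; exists q => //; split;
        rewrite qx // Va; exists q.
    exact: openI (oset_open W) (oset_open V).
  have [|b pb bS] := Sopen p; first by split=> //; rewrite Va; exists p.
  exists b => //; split; last by move=> _ [q /bS[_ ?] <-].
  by apply: Csub CW => _ [q /bS[? _] <-].
exists n, (fun i => D (b i)); split=> [i | x].
  by have [? ?] := bC i; split=> //; exists (b i).
by rewrite Va => -[p /bcov[i pi] <-]; exists i; exists p.
Qed.
End BasicOpens.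

(** * Colimits of presheaves of modules *)

(** Systems of mere presheaves, since sectionwise tensor products need not be sheaves. *)
Record pmod_system (X : ringed_space) (I : directed_set) := PmodSystem {
  ps_ob :> I -> pmod X;
  ps_map : forall i j, dle i j -> pmor (ps_ob i) (ps_ob j);
  ps_id : forall i (ii : dle i i) (U : opens X) s, ps_map ii U s = s;
  ps_comp : forall i j k (ij : dle i j) (jk : dle j k) (ik : dle i k)
      (U : opens X) s, ps_map jk U (ps_map ij U s) = ps_map ik U s }.
Arguments ps_map {X I} p {i j} ij.

(** The base index [i] covers the case of an empty [T] and makes the bound reachable from a given
    stage. *)
Lemma directed_bound (I : directed_set) (T : finType) (k : T -> I) (i : I) :
  exists2 j, dle i j & forall t, dle (k t) j.
Proof.
suff [j ij jk] : exists2 j, dle i j & forall t, t \in enum T -> dle (k t) j.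
  by exists j => // t; apply: jk; rewrite mem_enum.
elim: (enum T) => [|t s [j ij js]]; first by exists i => //; exact: dle_refl.
have [l [jl tl]] := d_directed j (k t).
exists l; first exact: dle_trans jl.
by move=> u; rewrite inE => /orP[/eqP -> //|/js uj]; exact: dle_trans jl.
Qed.

Definition colim_pre (X : ringed_space) (I : directed_set)
  (D : pmod_system X I) (U : opens X) : Type := {i : I & D i U}.
HB.instance Definition _ X I D U := gen_eqMixin (@colim_pre X I D U).
HB.instance Definition _ X I D U := gen_choiceMixin (@colim_pre X I D U).

Section Colimit.
Variables (X : ringed_space) (I : directed_set) (D : pmod_system X I).
Implicit Types (U V W : opens X).

Lemma ps_map_id i (ii : dle i i) U (s : D i U) : ps_map D ii U s = s.
Proof. exact: ps_id. Qed.

Lemma ps_mapA i j k (ij : dle i j) (jk : dle j k) U (s : D i U) :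
  ps_map D jk U (ps_map D ij U s) = ps_map D (dle_trans ij jk) U s.
Proof. exact: ps_comp. Qed.

Lemma ps_map_irr i j (h h' : dle i j) : ps_map D h = ps_map D h'.
Proof. by rewrite (Prop_irrelevance h h'). Qed.

Definition eventually_eq U i (s : D i U) j (t : D j U) : Prop :=
  exists k (ik : dle i k) (jk : dle j k), ps_map D ik U s = ps_map D jk U t.

Lemma eventually_eq_map U i j (ij : dle i j) (s : D i U) :
  eventually_eq (ps_map D ij U s) s.
Proof. by exists j, (dle_refl j), ij; rewrite ps_map_id. Qed.

Section Module.
Variable U : opens X.

Definition colim_eqv : rel (colim_pre D U) :=
  fun s t => `[< eventually_eq (tagged s) (tagged t) >].

Fact colim_eqv_refl : reflexive colim_eqv.
Proof.
by move=> s; apply/asboolP; exists (tag s), (dle_refl _), (dle_refl _).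
Qed.
Fact colim_eqv_sym : symmetric colim_eqv.
Proof.
by move=> s t; apply/asboolP/asboolP => -[k [h [h' e]]]; exists k, h', h.
Qed.
Fact colim_eqv_trans : transitive colim_eqv.
Proof.
move=> t s u /asboolP[k [h1 [h2 e]]] /asboolP[l [h3 [h4 e']]].
have [m [km lm]] := d_directed k l.
apply/asboolP; exists m, (dle_trans h1 km), (dle_trans h4 lm).
rewrite -!ps_mapA e -e' !ps_mapA.
by rewrite (ps_map_irr (dle_trans h2 km) (dle_trans h3 lm)).
Qed.
Canonical colim_equiv :=
  EquivRel colim_eqv colim_eqv_refl colim_eqv_sym colim_eqv_trans.

Definition colim := {eq_quot colim_eqv}.
HB.instance Definition _ := Choice.on colim.
HB.instance Definition _ := EqQuotient.on colim.

Definition cclass i (s : D i U) : colim :=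
  \pi_({eq_quot colim_eqv}) (Tagged (fun i => D i U) s : colim_pre D U).

Lemma cclassP i (s : D i U) j (t : D j U) :
  cclass s = cclass t <-> eventually_eq s t.
Proof.
have -> : (cclass s = cclass t) <-> colim_equiv
    (Tagged (fun i => D i U) s) (Tagged (fun i => D i U) t).
  by split=> /(@eqmodP _ colim_equiv).
by split=> /asboolP.
Qed.

Lemma cclass_map i j (ij : dle i j) (s : D i U) :
  cclass (ps_map D ij U s) = cclass s.
Proof. exact/cclassP/eventually_eq_map. Qed.

Lemma colimW (K : colim -> Prop) :
  (forall i (s : D i U), K (cclass s)) -> forall x, K x.
Proof. by move=> h x; rewrite -[x]reprK; case: (repr x). Qed.

(** Directedness brings both classes to one stage, where the module laws of [D i U] can be used. *)
Lemma colimP2 (x y : colim) :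
  exists i (s t : D i U), x = cclass s /\ y = cclass t.
Proof.
elim/colimW: x => i s; elim/colimW: y => j t.
have [k [ik jk]] := d_directed i j.
by exists k, (ps_map D ik U s), (ps_map D jk U t); rewrite !cclass_map.
Qed.

Lemma colimP3 (x y z : colim) :
  exists i (s t u : D i U), [/\ x = cclass s, y = cclass t & z = cclass u].
Proof.
have [i [s [t [-> ->]]]] := colimP2 x y; elim/colimW: z => j u.
have [k [ik jk]] := d_directed i j.
exists k, (ps_map D ik U s), (ps_map D ik U t), (ps_map D jk U u).
by rewrite !cclass_map.
Qed.

(** The stage is picked by choice from [d_inhabited]; [colim_zeroE] shows that it does not
    matter. *)
Definition colim_zero : colim :=
  cclass (0 : D (sval (cid (let: inhabits i := d_inhabited I in
    ex_intro (fun=> True) i Logic.I))) U).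
Definition colim_opp (x : colim) : colim := cclass (- tagged (repr x)).
Definition colim_add (x y : colim) : colim :=
  let: exist k (conj ik jk) := cid (d_directed (tag (repr x)) (tag (repr y))) in
  cclass (ps_map D ik U (tagged (repr x)) + ps_map D jk U (tagged (repr y))).
Definition colim_scale a (x : colim) : colim := cclass (a *: tagged (repr x)).

Lemma cclass_repr x : cclass (tagged (repr x)) = x.
Proof. by rewrite -[RHS]reprK /cclass; case: (repr x). Qed.

Lemma colim_zeroE i : colim_zero = cclass (0 : D i U).
Proof.
rewrite /colim_zero; move: (sval _) => j; apply/cclassP.
by have [k [ik jk]] := d_directed i j; exists k, jk, ik; rewrite !pmor0.
Qed.

Lemma colim_oppE i (s : D i U) : colim_opp (cclass s) = cclass (- s).
Proof.
apply/cclassP; have /cclassP[k [h [h' e]]] := cclass_repr (cclass s).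
by exists k, h, h'; rewrite -!scaleN1r !pmorZ e.
Qed.

Lemma colim_scaleE a i (s : D i U) :
  colim_scale a (cclass s) = cclass (a *: s).
Proof.
apply/cclassP; have /cclassP[k [h [h' e]]] := cclass_repr (cclass s).
by exists k, h, h'; rewrite !pmorZ e.
Qed.

(** The representatives chosen by [colim_add] agree with [s] and [t] at stages [m] and [l], hence
    both do at the common bound [n]. *)
Lemma colim_addE i (s t : D i U) :
  colim_add (cclass s) (cclass t) = cclass (s + t).
Proof.
rewrite /colim_add; case: cid => k [h1 h2].
have := cclass_repr (cclass s); rewrite -(cclass_map h1).
have := cclass_repr (cclass t); rewrite -(cclass_map h2).
move: (ps_map D h1 U _) (ps_map D h2 U _) => s' t'.
move=> /cclassP[l [kl [il et]]] /cclassP[m [km [im es]]].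
have [n [ln mn]] := d_directed l m.
apply/cclassP; exists n, (dle_trans kl ln), (dle_trans il ln).
rewrite !pmorD -(ps_mapA kl ln t') -(ps_mapA il ln t) et; congr (_ + _).
rewrite (ps_map_irr (dle_trans kl ln) (dle_trans km mn)).
rewrite (ps_map_irr (dle_trans il ln) (dle_trans im mn)).
by rewrite -!ps_mapA es.
Qed.

Fact colim_addA : associative colim_add.
Proof.
move=> x y z; have [i [s [t [u [-> -> ->]]]]] := colimP3 x y z.
by rewrite !colim_addE addrA.
Qed.
Fact colim_addC : commutative colim_add.
Proof.
move=> x y; have [i [s [t [-> ->]]]] := colimP2 x y.
by rewrite !colim_addE addrC.
Qed.
Fact colim_add0 : left_id colim_zero colim_add.
Proof. by elim/colimW => i s; rewrite (colim_zeroE i) colim_addE add0r. Qed.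
Fact colim_addN : left_inverse colim_zero colim_opp colim_add.
Proof.
by elim/colimW => i s; rewrite (colim_zeroE i) colim_oppE colim_addE addNr.
Qed.
HB.instance Definition _ := GRing.isZmodule.Build colim
  colim_addA colim_addC colim_add0 colim_addN.

Lemma cclassD i (s t : D i U) : cclass (s + t) = cclass s + cclass t.
Proof. by rewrite [RHS]colim_addE. Qed.
Lemma cclass0 i : cclass (0 : D i U) = 0.
Proof. exact/esym/colim_zeroE. Qed.

Fact colim_scaleA a b x :
  colim_scale a (colim_scale b x) = colim_scale (a * b) x.
Proof. by elim/colimW: x => i s; rewrite !colim_scaleE scalerA. Qed.
Fact colim_scale1 : left_id 1 colim_scale.
Proof. by elim/colimW => i s; rewrite colim_scaleE scale1r. Qed.
Fact colim_scaleDr : right_distributive colim_scale +%R.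
Proof.
move=> a x y; have [i [s [t [-> ->]]]] := colimP2 x y.
by rewrite -cclassD !colim_scaleE -cclassD scalerDr.
Qed.
Fact colim_scaleDl x : {morph colim_scale^~ x : a b / a + b}.
Proof.
by move=> a b; elim/colimW: x => i s; rewrite !colim_scaleE -cclassD scalerDl.
Qed.
HB.instance Definition _ := GRing.Zmodule_isLmodule.Build (osec U) colim
  colim_scaleA colim_scale1 colim_scaleDr colim_scaleDl.

Lemma cclassZ a i (s : D i U) : cclass (a *: s) = a *: cclass s.
Proof. by rewrite [RHS]colim_scaleE. Qed.

Lemma cclass_eq0 i (s : D i U) :
  cclass s = 0 <-> exists k (ik : dle i k), ps_map D ik U s = 0.
Proof.
rewrite -(cclass0 i) cclassP; split=> [[k [h [h' e]]]|[k [h e]]].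
  by exists k, h; rewrite e pmor0.
by exists k, h, h; rewrite e pmor0.
Qed.
End Module.

Definition colim_res U V (VU : V `<=` U) (x : colim U) : colim V :=
  cclass (pres _ VU (tagged (repr x))).

Lemma colim_resE U V (VU : V `<=` U) i (s : D i U) :
  colim_res VU (cclass s) = cclass (pres _ VU s).
Proof.
apply/cclassP; have /cclassP[k [h [h' e]]] := cclass_repr (cclass s).
by exists k, h, h'; rewrite !pmor_res e.
Qed.

(** The sectionwise colimit, in general not a sheaf. *)
Program Definition pcolim : pmod X :=
  @PMod X (fun U => colim U) colim_res _ _ _ _.
Next Obligation.
move=> U V VU x y /=; have [i [s [t [-> ->]]]] := colimP2 x y.
by rewrite -cclassD !colim_resE -cclassD presD.
Qed.
Next Obligation.
move=> U V VU a /=; elim/colimW => i s.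
by rewrite -cclassZ !colim_resE -cclassZ presZ.
Qed.
Next Obligation.
by move=> U UU /=; elim/colimW => i s; rewrite colim_resE pres_id.
Qed.
Next Obligation.
move=> U V W VU WV WU /=; elim/colimW => i s.
by rewrite !colim_resE (pres_comp VU WV WU).
Qed.

Program Definition pcolim_in i : pmor (D i) pcolim :=
  @PMor X (D i) pcolim (fun U s => cclass s) _ _.
Next Obligation. by move=> i U a s t /=; rewrite cclassD cclassZ. Qed.
Next Obligation. by move=> i U V VU s /=; rewrite colim_resE. Qed.

End Colimit.

(** * Filtered colimits of quasi-coherent sheaves *)

Section Gluing.
Variable X : ringed_space.
Implicit Types (U V W : opens X).

Lemma opensIl U V : opensI U V `<=` U. Proof. by move=> x []. Qed.
Lemma opensIr U V : opensI U V `<=` V. Proof. by move=> x []. Qed.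

Lemma presB (P : pmod X) U V (VU : V `<=` U) s t :
  pres P VU (s - t) = pres P VU s - pres P VU t.
Proof. by rewrite presD presN. Qed.

Lemma pmorN (F G : pmod X) (f : pmor F G) U s : f U (- s) = - f U s.
Proof. by rewrite -!scaleN1r pmorZ. Qed.

Lemma pmorB (F G : pmod X) (f : pmor F G) U s t : f U (s - t) = f U s - f U t.
Proof. by rewrite pmorD pmorN. Qed.

(** Reduces agreement on all common opens to pairwise intersections. As [sheaf_axiom] takes a set of
    opens, it is applied to all opens contained in some [W k], an index being chosen for each. *)
Lemma omod_glue (G : omod X) U (K : Type) (W : K -> opens X)
    (WU : forall k, W k `<=` U) (t : forall k, G (W k)) :
  (forall x, oset U x -> exists k, oset (W k) x) ->
  (forall k l, pres G (@opensIl (W k) (W l)) (t k) =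
               pres G (@opensIr (W k) (W l)) (t l)) ->
  exists s : G U, forall k, pres G (WU k) s = t k.
Proof.
move=> cov agree.
have agreeV V k l (Vk : V `<=` W k) (Vl : V `<=` W l) :
    pres G Vk (t k) = pres G Vl (t l).
  have i : V `<=` opensI (W k) (W l).
    by move=> x Vx; split; [apply: Vk | apply: Vl].
  rewrite -(pres_comp (@opensIl _ _) i) agree.
  exact: pres_comp.
pose C V := exists k, V `<=` W k.
have CU V : C V -> V `<=` U by move=> [k Vk]; exact: subset_trans (WU k).
have covC x : oset U x -> exists2 V, C V & oset V x.
  by move=> /cov[k Wx]; exists (W k) => //; exists k.
pose fam V (c : C V) : G V := pres G (svalP (cid c)) (t (sval (cid c))).
have [V V' c c' Z ZV ZV'|s [sP _]] := omod_sheaf CU covC (s := fam).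
  rewrite /fam; set h := svalP (cid c); set h' := svalP (cid c').
  rewrite (pres_comp h ZV (subset_trans ZV h)).
  by rewrite (pres_comp h' ZV' (subset_trans ZV' h')); exact: agreeV.
exists s => k; have Ck : C (W k) by exists k.
rewrite (pres_irr (WU k) (CU _ Ck)) sP /fam.
by rewrite (agreeV _ _ k _ (@subset_refl _ (W k))) pres_id.
Qed.

Variable P : pmod X.

(** Translates the encoding of a section by its local representatives into restrictions in the
    sheaf. *)
Lemma shmemE U (s : sheafify P U) V (VU : V `<=` U) (t : P V) :
  shmem s t <-> pres (sheafify P) VU s = sh_unit P V t.
Proof.
have tt : shmem (sh_unit P V t) t.
  by rewrite -[X in shmem _ X](pres_id (@subset_refl _ V)); exact: shmem_unit.
split=> [st | e].
  apply: shsec_eq => x Vx; exists V, t; split=> //.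
  exact: shmem_res.
have : shmem (sh_res VU s) t by rewrite [sh_res VU s]e.
by move=> /shmem_resE[].
Qed.

(** Together with [sh_unit_inj]: the unit is an isomorphism on stalks. *)
Lemma sh_unit_surj U (s : sheafify P U) x : oset U x ->
  exists V (VU : V `<=` U) (t : P V),
    oset V x /\ pres (sheafify P) VU s = sh_unit P V t.
Proof.
move=> /(shmem_cover s)[V [t [st Vx]]].
by exists V, (shmem_sub st), t; split=> //; apply/shmemE.
Qed.

Lemma sh_unit_inj U (t : P U) x : sh_unit P U t = 0 -> oset U x ->
  exists V (VU : V `<=` U), oset V x /\ pres P VU t = 0.
Proof.
move=> t0 Ux; have UU := @subset_refl _ U.
have t_mem : shmem (0 : sheafify P U) t by apply/(shmemE _ UU); rewrite pres0.
have z_mem : shmem (0 : sheafify P U) (0 : P U) by exact: shmem0.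
have [W [h [h' [Wx e]]]] := shmem_compat t_mem z_mem Ux Ux.
by exists W, h; rewrite e pres0.
Qed.
End Gluing.

(** * Stalkwise colimits and their sections over basic opens *)

Section LocalColimit.
Variables (X : ringed_space) (I : directed_set) (D : pmod_system X I).
Implicit Types (U V W : opens X).

(* The colimit condition on stalks. *)
Definition is_local_colimit (G : pmod X) (q : forall i, pmor (D i) G) : Prop :=
  [/\ forall i j (ij : dle i j) U s, q j U (ps_map D ij U s) = q i U s,
      forall U (s : G U) x, oset U x ->
        exists V (VU : V `<=` U) i (t : D i V),
          oset V x /\ pres G VU s = q i V t &
      forall i U (t : D i U) x, q i U t = 0 -> oset U x ->
        exists V (VU : V `<=` U) j (ij : dle i j),
          oset V x /\ ps_map D ij V (pres (D i) VU t) = 0].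

Definition sh_colim_in i : pmor (D i) (sheafify (pcolim D)) :=
  pmor_comp (sh_unit (pcolim D)) (pcolim_in D i).

(** The presheaf colimit has these properties already on sections, and the unit is an isomorphism on
    stalks. *)
Lemma sheafify_pcolim_is_local_colimit :
  @is_local_colimit (sheafify (pcolim D)) sh_colim_in.
Proof.
split=> [i j ij U s | U s x Ux | i U t x t0 Ux].
- by rewrite /sh_colim_in /= cclass_map.
- have [V [VU [t [Vx e]]]] := sh_unit_surj s Ux.
  elim/(@colimW _ _ D V): t e => i t e.
  by exists V, VU, i, t.
- have [V [VU [Vx]]] := sh_unit_inj t0 Ux.
  by rewrite -pmor_res => /cclass_eq0[k [ik e]]; exists V, VU, k, ik.
Qed.

Variables (G : omod X) (q : forall i, pmor (D i) G).
Hypothesis qP : is_local_colimit q.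
Hypothesis D_sheaf : forall i, sheaf_axiom (fun U V VU => pres (D i) VU).
Variables (U : opens X) (c : affine_chart U).

(** Near each point [t] dies at some stage. By quasi-compactness finitely many stages suffice, and
    at a bound of them [t] vanishes locally, hence vanishes because [D l] is a sheaf. *)
Lemma local_colimit_basic_inj V i (t : D i V) : is_basic c V ->
  q i V t = 0 -> exists j (ij : dle i j), ps_map D ij V t = 0.
Proof.
case: qP => qmap _ qinj Vbasic t0.
pose C W := exists (WV : W `<=` V) j (ij : dle i j),
  ps_map D ij W (pres (D i) WV t) = 0.
have [W W' W'W [WV [j [ij e]]]|x Vx|n [W [WC cov]]] :=
    basic_quasi_compact (C := C) Vbasic.
- exists (subset_trans W'W WV), j, ij.
  by rewrite -(pres_comp WV W'W) pmor_res e pres0.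
- have [W [WV [j [ij [Wx e]]]]] := qinj _ _ _ _ t0 Vx.
  by exists W; split=> //; exists WV, j, ij.
have /choice[j jP] : forall k, exists j,
    exists (ij : dle i j) (WV : W k `<=` V),
    ps_map D ij (W k) (pres (D i) WV t) = 0.
  by move=> k; have [_ _ [WV [j [ij e]]]] := WC k; exists j, ij, WV.
have [l il jl] := directed_bound j i.
exists l, il; apply: (@omod_sep _ (OMod (@D_sheaf l))) => x /cov[k Wx].
have [ij [WV e]] := jP k.
exists (W k), WV; split=> //=.
rewrite pres0 -pmor_res (ps_map_irr D il (dle_trans ij (jl k))).
by rewrite -ps_mapA e pmor0.
Qed.

(** Finitely many local preimages of [s] are moved to one stage and glued at a later one. *)
Lemma local_colimit_basic_surj V (s : G V) : is_basic c V ->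
  exists i (t : D i V), q i V t = s.
Proof.
case: qP => qmap qsurj _ Vbasic.
pose C W := exists (WV : W `<=` V) i (t : D i W), pres G WV s = q i W t.
have [W W' W'W [WV [i [t e]]]|x Vx|n [W [WC cov]]] :=
    basic_quasi_compact (C := C) Vbasic.
- exists (subset_trans W'W WV), i, (pres (D i) W'W t).
  by rewrite pmor_res -e (pres_comp WV W'W (subset_trans W'W WV)).
- have [W [WV [i [t [Wx e]]]]] := qsurj _ s _ Vx.
  by exists W; split=> //; exists WV, i, t.
have WV k : W k `<=` V by have [] := WC k.
have /choice[i iP] : forall k, exists i, exists t : D i (W k),
    pres G (WV k) s = q i (W k) t.
  move=> k; have [_ _ [h [i [t e]]]] := WC k; exists i, t.
  by rewrite -e; exact: pres_irr.
have [i0] := d_inhabited I.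
have [l _ il] := directed_bound i i0.
have {iP il}/all_sig[t tP] k : {t : D l (W k) | pres G (WV k) s = q l (W k) t}.
  by apply: cid; have [t e] := iP k; exists (ps_map D (il k) _ t); rewrite qmap.
(* The preimages agree on overlaps only after [q l]. The overlaps are basic, so each of the finitely
   many differences vanishes at a later stage. *)
pose d (k : 'I_n * 'I_n) : D l (opensI (W k.1) (W k.2)) :=
  pres (D l) (@opensIl _ _ _) (t k.1) - pres (D l) (@opensIr _ _ _) (t k.2).
have /choice[j jP] : forall k, exists j, exists lj : dle l j,
    ps_map D lj _ (d k) = 0.
  move=> k; apply: local_colimit_basic_inj.
    by apply: is_basicI; [have [] := WC k.1 | have [] := WC k.2].
  rewrite /d pmorB !pmor_res -!tP.
  have kV := subset_trans (@opensIl _ (W k.1) (W k.2)) (WV k.1).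
  by rewrite (pres_comp (WV k.1) _ kV) (pres_comp (WV k.2) _ kV) subrr.
have [m lm jm] := directed_bound j l.
have [||r rP] := @omod_glue _ (OMod (@D_sheaf m)) V _ W WV
  (fun k => ps_map D lm _ (t k)) => //.
- move=> k k'; apply/eqP; rewrite -subr_eq0 /= -!pmor_res -pmorB.
  have [lj e] := jP (k, k').
  rewrite (ps_map_irr D lm (dle_trans lj (jm (k, k')))) -ps_mapA.
  by rewrite [X in ps_map D (jm _) _ X]e pmor0.
exists m, r; apply: omod_sep => x /cov[k Wx]; exists (W k), (WV k); split=> //.
by rewrite tP -pmor_res [X in q m _ X]rP qmap.
Qed.
End LocalColimit.

Lemma iter_pmor (X : ringed_space) (F G : pmod X) (f : pmor F G) (U : opens X)
  a n (s : F U) : f U (iter n ( *:%R a) s) = iter n ( *:%R a) (f U s).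
Proof. by elim: n => //= n <-; rewrite pmorZ. Qed.

(** Over the chart and its basic opens, sections of [G] are the directed colimit of those of the
    [D i], and localization commutes with directed colimits. *)
Lemma local_colimit_quasi_coherent (X : ringed_space) (I : directed_set)
    (D : pmod_system X I) (G : omod X) (q : forall i, pmor (D i) G)
    (D_sheaf : forall i, sheaf_axiom (fun U V VU => pres (D i) VU)) :
  (forall i, quasi_coherent (OMod (@D_sheaf i))) ->
  is_local_colimit q -> quasi_coherent G.
Proof.
move=> Dqc qP U c a V VU Va.
have [qmap _ _] := qP.
(* [U] is the basic open of 1, so the two lemmas apply to it as well as to [V]. *)
have Ub := is_basic_chart c.
have Vb : is_basic c V by exists a.
have inj := local_colimit_basic_inj qP D_sheaf.
have surj := local_colimit_basic_surj qP D_sheaf.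
have loc i := Dqc i U c a V VU Va.
split.
- have ainj : injective ( *:%R (ores VU (chart_map c a)) : G V -> G V).
    move=> s s' /eqP; rewrite -subr_eq0 -scalerBr => /eqP e.
    apply/eqP; rewrite -subr_eq0; apply/eqP; move: e.
    have [i [t <-]] := surj _ _ _ (s - s') Vb.
    rewrite -pmorZ => /(inj _ _ _ _ _ Vb)[j [ij]]; rewrite pmorZ.
    have [/bij_inj jinj _ _] := loc j.
    rewrite -(scaler0 _ (ores VU (chart_map c a))) => /jinj e.
    by rewrite -(qmap _ _ ij) e pmor0.
  have asurj s : exists t, ores VU (chart_map c a) *: t = s :> G V.
    have [i [t <-]] := surj _ _ _ s Vb.
    have [[g _ gK] _ _] := loc i.
    by exists (q i V (g t)); rewrite -pmorZ gK.
  have [g gK] := choice asurj.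
  by exists g => // s; apply: ainj; rewrite gK.
- move=> s; have [i [t <-]] := surj _ _ _ s Vb.
  have [_ /(_ t)[k [r e]] _] := loc i.
  by exists k, (q i U r); rewrite -iter_pmor -pmor_res e.
- move=> s; have [i [t <-]] := surj _ _ _ s Ub.
  rewrite -pmor_res => /(inj _ _ _ _ _ Vb)[j [ij]]; rewrite pmor_res => e.
  have [_ _ /(_ _ e)[k ek]] := loc j.
  by exists k; rewrite -(qmap _ _ ij) -iter_pmor ek pmor0.
Qed.

Section ColimitLift.
Variables (X : ringed_space) (I : directed_set) (D : pmod_system X I).
Variables (G : pmod X) (q : forall i, pmor (D i) G).
Hypothesis q_map : forall i j (ij : dle i j) (U : opens X) s,
  q j U (ps_map D ij U s) = q i U s.

Definition pcolim_lift_fun (U : opens X) (x : colim D U) : G U :=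
  q (tag (repr x)) U (tagged (repr x)).

Lemma pcolim_lift_funE (U : opens X) i (s : D i U) :
  pcolim_lift_fun (cclass s) = q i U s.
Proof.
rewrite /pcolim_lift_fun.
have /cclassP[k [h [h' e]]] := cclass_repr (cclass s).
by rewrite -(q_map h) e q_map.
Qed.

Program Definition pcolim_lift : pmor (pcolim D) G :=
  @PMor X (pcolim D) G pcolim_lift_fun _ _.
Next Obligation.
move=> U a x y; have [i [s [t [-> ->]]]] := colimP2 x y.
by rewrite -cclassZ -cclassD !pcolim_lift_funE pmorD pmorZ.
Qed.
Next Obligation.
move=> U V VU; elim/colimW => i s.
by rewrite /= colim_resE !pcolim_lift_funE pmor_res.
Qed.
End ColimitLift.

(** * Direct limits in Qcoh(X) *)

Section QcohLimit.
Variables (X : ringed_space) (I : directed_set).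
Variable D : direct_system (Qcoh X) I.

Program Definition qcoh_system : pmod_system X I :=
  @PmodSystem X I (fun i => qcoh_omod (D i)) (fun i j ij => ds_map D ij) _ _.
Next Obligation. move=> i ii U s.
exact: (congr1 (fun k : pmor _ _ => k U s) (ds_id D ii)). Qed.
Next Obligation. move=> i j k ij jk ik U s.
exact: (congr1 (fun k : pmor _ _ => k U s) (ds_comp D ij jk ik)). Qed.

(** Since [L] is quasi-coherent, the universal property of [T] makes [T] a retract of [L]. A section
    of [T] is sent to [L], written locally as coming from some [D i], and sent back; a section of
    [D i] that dies in [T] dies in [L]. *)
Lemma qcoh_direct_limit_local (T : Qcoh X) (c : cocone D T) :
  is_direct_limit c ->
  @is_local_colimit X I qcoh_system (qcoh_omod T) (fun i => c i).
Proof.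
move=> climit.
pose q i : pmor (qcoh_system i) (qcoh_omod T) := c i.
have qmap i j (ij : dle i j) (U : opens X) s :
    q j U (ps_map qcoh_system ij U s) = q i U s.
  exact: (congr1 (fun k : pmor _ _ => k U s) (cc_comp c ij)).
pose L := sheafify (pcolim qcoh_system).
have locL := sheafify_pcolim_is_local_colimit qcoh_system.
have [dmap dsurj dinj] := locL.
have Lqc : quasi_coherent L.
  apply: (@local_colimit_quasi_coherent X I qcoh_system L (sh_colim_in _)
    (fun i => @omod_sheaf X (qcoh_omod (D i))) _ locL) => i.
  (* Destructing the sheaf identifies it with the [OMod] rebuilt from its own sheaf axiom. *)
  by have := qcoh_prop (D i); rewrite /=; case: (qcoh_omod (D i)).
pose Q : Qcoh X := QCoh Lqc.
have dQ i j (ij : dle i j) :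
    comp (sh_colim_in qcoh_system j : hom (D j) Q) (ds_map D ij) =
    (sh_colim_in qcoh_system i : hom (D i) Q).
  by apply: pmor_eq => U s; exact: dmap.
have [h [hd _]] := climit Q (Cocone dQ).
pose g : hom Q T := sheafify_lift (pcolim_lift qmap).
have gd i : comp g (sh_colim_in qcoh_system i : hom (D i) Q) = c i.
  apply: pmor_eq => U s.
  have gu U' t : (g : pmor _ _) U' (sh_unit _ U' t) =
      pcolim_lift qmap U' t.
    have UU := @subset_refl _ U'.
    have m : shmem (sh_unit (pcolim qcoh_system) U' t) t.
      by apply/(shmemE _ UU); rewrite pres_id.
    rewrite -[LHS](pres_id UU).
    exact: (@lift_funP _ _ _ (pcolim_lift qmap) U' _ U' t UU m).
  by rewrite -[RHS](pcolim_lift_funE qmap); exact: gu.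
(* Both sides are endomorphisms of [T] compatible with the cocone [c]. *)
have gh : comp g h = idm T.
  have [k [_ kuniq]] := climit T c.
  have <- : k = comp g h.
    by apply: kuniq => i; rewrite -(compA g h (c i)) (hd i); exact: gd.
  by apply: kuniq => i; rewrite comp1m.
split=> // [U s x Ux | i U t x t0 Ux].
  have [V [VU [i [t [Vx e]]]]] := dsurj U ((h : pmor _ _) U s) x Ux.
  exists V, VU, i, t; split=> //.
  have -> : s = (g : pmor _ _) U ((h : pmor _ _) U s).
    by have := congr1 (fun k : pmor _ _ => k U s) gh.
  by rewrite -pmor_res e; exact: (congr1 (fun k : pmor _ _ => k V t) (gd i)).
apply: (dinj i U t x _ Ux).
rewrite -[LHS](congr1 (fun k : pmor _ _ => k U t) (hd i)) /=.
by rewrite [X in (h : pmor _ _) U X]t0 pmor0.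
Qed.
End QcohLimit.

(** * Splitting the pullbacks *)

Section KernelLift.
Variables (X : ringed_space) (F G T : omod X).
Variables (f : pmor F G) (g : pmor G T).
Hypothesis f_mono : mono_exact f.
Hypothesis fg_exact : middle_exact f g.

(** Exactness gives preimages only locally; as [f] is injective on sections, they agree on overlaps
    and glue. *)
Lemma kernel_section (U : opens X) (s : G U) :
  g U s = 0 -> exists z : F U, f U z = s.
Proof.
move=> /(fg_exact.2 U s) loc.
pose K := {V : opens X | exists (VU : V `<=` U) (r : F V), f V r = pres G VU s}.
have KU (k : K) : sval k `<=` U by case: k => V [].
have /all_sig[r rP] k : {r : F (sval k) | f (sval k) r = pres G (KU k) s}.
  apply: cid; have [VU [r e]] := svalP k; exists r.
  by rewrite e; exact: pres_irr.
have [x Ux|k l|z zP] := @omod_glue _ F U K _ KU r.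
- have [V [VU [t [Vx e]]]] := loc x Ux.
  have kV : exists (VU : V `<=` U) (r : F V), f V r = pres G VU s.
    by exists VU, t.
  by exists (exist _ V kV).
- apply: f_mono; rewrite !pmor_res !rP.
  have lU := subset_trans (@opensIl _ (sval k) (sval l)) (KU k).
  by rewrite (pres_comp (KU k) _ lU) (pres_comp (KU l) _ lU).
- exists z; apply: omod_sep => x Ux.
  have [V [VU [t [Vx e]]]] := loc x Ux.
  have kV : exists (VU : V `<=` U) (r : F V), f V r = pres G VU s.
    by exists VU, t.
  exists V, VU; split=> //.
  rewrite !(pres_irr VU (KU (exist _ V kV))) -pmor_res.
  by rewrite [pres F _ z](zP (exist _ V kV)); exact: (rP (exist _ V kV)).
Qed.

(** Injectivity of [f] makes the sectionwise preimages linear and compatible with restriction. *)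
Lemma kernel_lift (H : pmod X) (u : pmor H G) :
  (forall (U : opens X) t, g U (u U t) = 0) ->
  exists r : pmor H F, forall (U : opens X) t, f U (r U t) = u U t.
Proof.
move=> gu0.
have /all_sig[r rP] (U : opens X) :
    {r : H U -> F U | forall t, f U (r t) = u U t}.
  apply: (@all_sig _ _ (fun t z => f U z = u U t)) => t; apply: cid.
  exact/kernel_section/gu0.
have r_linear (U : opens X) : linear (r U).
  by move=> a s t; apply: f_mono; rewrite pmorD pmorZ !rP pmorD pmorZ.
have r_res (U V : opens X) (VU : V `<=` U) s :
    r V (pres H VU s) = pres F VU (r U s).
  by apply: f_mono; rewrite rP !pmor_res rP.
by exists (PMor r_linear r_res).
Qed.
End KernelLift.

Program Definition psum (X : ringed_space) (F H : pmod X) : pmod X :=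
  @PMod X (fun U => (F U * H U)%type)
    (fun U V VU p => (pres F VU p.1, pres H VU p.2)) _ _ _ _.
Next Obligation. by move=> X F H U V VU [a b] [a' b'] /=; rewrite !presD. Qed.
Next Obligation. by move=> X F H U V VU a [b b'] /=; rewrite !presZ. Qed.
Next Obligation. by move=> X F H U UU [a b] /=; rewrite !pres_id. Qed.
Next Obligation.
by move=> X F H U V W VU WV WU [a b] /=; rewrite !(pres_comp VU WV WU).
Qed.

Program Definition psum_fst (X : ringed_space) (F H : pmod X) :
  pmor (psum F H) F := @PMor X (psum F H) F (fun U p => p.1) _ _.
Next Obligation. by []. Qed.
Next Obligation. by []. Qed.

(* The pullback of [g] along a map [p i = g \o s i] is the direct sum of the
   kernel [F] and of [D i]; under this identification the transition maps of
   the pullbacks become triangular, with off-diagonal part [r]. *)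
Section SplitPullback.
Variables (X : ringed_space) (F G T : omod X).
Variables (f : pmor F G) (g : pmor G T).
Hypothesis f_mono : mono_exact f.
Hypothesis fg_exact : middle_exact f g.
Variables (I : directed_set) (D : pmod_system X I).
Variables (p : forall i, pmor (D i) T) (s : forall i, pmor (D i) G).
Hypothesis pP : is_local_colimit p.
Hypothesis gs : forall i (U : opens X) t, g U (s i U t) = p i U t.

(** The lifts [s i] need not commute with the transition maps, but [s i] and [s j] after the
    transition both lie over [p i], so their difference takes values in the kernel [F] of [g]. *)
Lemma lift_difference i j (ij : dle i j) : exists r : pmor (D i) F,
  forall (U : opens X) t, f U (r U t) = s i U t - s j U (ps_map D ij U t).
Proof.
have [pmap _ _] := pP.
apply: (kernel_lift f_mono fg_exact
  (u := s i - pmor_comp (s j) (ps_map D ij))) => U t.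
by rewrite [X in g U X]/= -[X in g U X]/(_ - _) pmorB !gs pmap subrr.
Qed.

Definition lift_diff i j (ij : dle i j) : pmor (D i) F :=
  sval (cid (lift_difference ij)).

Lemma lift_diffE i j (ij : dle i j) (U : opens X) t :
  f U (lift_diff ij U t) = s i U t - s j U (ps_map D ij U t).
Proof. exact: (svalP (cid (lift_difference ij))). Qed.

Program Definition split_map i j (ij : dle i j) :
    pmor (psum F (D i)) (psum F (D j)) :=
  @PMor X (psum F (D i)) (psum F (D j))
    (fun U q => (q.1 + lift_diff ij U q.2, ps_map D ij U q.2)) _ _.
Next Obligation.
move=> i j ij U a [z t] [z' t'] /=; rewrite !pmorD !pmorZ.
by congr (_, _); rewrite addrACA -scalerDr.
Qed.
Next Obligation.
by move=> i j ij U V VU [z t] /=; rewrite !pmor_res presD.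
Qed.

Program Definition split_system : pmod_system X I :=
  @PmodSystem X I (fun i => psum F (D i)) split_map _ _.
Next Obligation.
move=> i ii U [z t]; congr (_, _) => /=; last exact: ps_map_id.
apply: f_mono; rewrite pmorD lift_diffE ps_map_id subrr addr0 //.
Qed.
Next Obligation.
move=> i j k ij jk ik U [z t]; congr (_, _) => /=; last exact: ps_comp.
(* The cocycle identity for [lift_diff], checked in [G]: the two terms in [s j] cancel. *)
apply: f_mono; rewrite !pmorD !lift_diffE (ps_comp ij jk ik).
by rewrite -!addrA; congr (_ + (_ + _)); rewrite addrA addNr add0r.
Qed.

Program Definition split_proj i : pmor (psum F (D i)) G :=
  @PMor X (psum F (D i)) G (fun U q => f U q.1 + s i U q.2) _ _.
Next Obligation.
by move=> i U a [z t] [z' t'] /=; rewrite !pmorD !pmorZ scalerDr addrACA.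
Qed.
Next Obligation. by move=> i U V VU [z t] /=; rewrite !pmor_res presD. Qed.

(** A five lemma argument on stalks. If [t] lifts [g y] locally, then [y - s i t] comes from [F]; if
    [f z + s i t] is 0, then so is [p i t], and [t] dies at a later stage. *)
Lemma split_system_local_colimit :
  @is_local_colimit X I split_system G split_proj.
Proof.
have [pmap psurj pinj] := pP.
have gf (U : opens X) z : g U (f U z) = 0 by exact: fg_exact.1.
have qmap i j (ij : dle i j) (U : opens X) (q : psum F (D i) U) :
    split_proj j U (split_map ij U q) = split_proj i U q.
  by rewrite /= pmorD lift_diffE -addrA subrK.
split=> [| U y x Ux | i U [z t] x e Ux]; first exact: qmap.
- have [V [VU [i [t [Vx e]]]]] := psurj U (g U y) x Ux.
  have [|z ez] := kernel_section f_mono fg_exact (s := pres G VU y - s i V t).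
    by rewrite pmorB gs pmor_res e subrr.
  by exists V, VU, i, (z, t); split; rewrite //= ez subrK.
- have pt0 : p i U t = 0.
    by have := congr1 (g U) e; rewrite /= pmorD gf add0r gs pmor0.
  have [V [VU [j [ij [Vx e']]]]] := pinj i U t x pt0 Ux.
  exists V, VU, j, ij; split=> //; congr (_, _) => //=.
  apply: f_mono; rewrite pmor0.
  (* At stage [j] the pair still projects to 0 in [G] and its second component is 0, so [f] kills
     the first one. *)
  have -> : 0 = split_proj i V (pres (psum F (D i)) VU (z, t)).
    by rewrite pmor_res [X in pres G VU X]e pres0.
  by rewrite -(qmap _ _ ij) /= [ps_map D ij V _]e' pmor0 addr0.
Qed.
End SplitPullback.

(** * Tensor products and filtered colimits *)

Section TensorColimit.
Variables (X : ringed_space) (I : directed_set) (D : pmod_system X I).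
Variables (M G : pmod X) (q : forall i, pmor (D i) G).
Hypothesis qP : is_local_colimit q.
Implicit Types (U V W : opens X).

Program Definition tensor_system : pmod_system X I :=
  @PmodSystem X I (fun i => ptensor M (D i))
    (fun i j ij => ptensor_mor M (ps_map D ij)) _ _.
Next Obligation.
move=> i ii U; elim/tensorW => s; rewrite [LHS]ptensor_morE; congr tclass.
by rewrite -[RHS]map_id; apply: eq_map => -[m t] /=; rewrite ps_map_id.
Qed.
Next Obligation.
move=> i j k ij jk ik U; elim/tensorW => s.
rewrite /= !ptensor_morE -map_comp; congr tclass.
by apply: eq_map => -[m t] /=; rewrite (ps_comp ij jk ik).
Qed.

Local Notation P := (pcolim tensor_system).

Definition tin i W (t : ptensor M (D i) W) : P W :=
  @cclass X I tensor_system W i t.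

Lemma tin_map i j (ij : dle i j) W (m : M W) (u : D i W) :
  tin (tpure m (ps_map D ij W u)) = tin (tpure m u).
Proof.
rewrite /tin -(@cclass_map X I tensor_system W i j ij (tpure m u)) /=.
by rewrite ptensor_morE.
Qed.

Lemma tin_res i W (Z : opens X) (ZW : Z `<=` W) (m : M W) (u : D i W) :
  pres P ZW (tin (tpure m u)) = tin (tpure (pres M ZW m) (pres (D i) ZW u)).
Proof. by rewrite /tin /= colim_resE /= ptensor_resE. Qed.

Section Test.
Variable V : opens X.

(* Locally [y] comes from some [u], and [m (x) y] goes to the class of
   [m (x) u]. *)
Definition tensor_test_rel (m : M V) (y : G V) W (r : P W) : Prop :=
  exists (WV : W `<=` V) i (u : D i W),
    q i W u = pres G WV y /\ r = tin (tpure (pres M WV m) u).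

(** A bilinear map into the sheaf associated with the colimit of the [ptensor M (D i)]; it inverts,
    up to sheafification, the comparison from this colimit to [ptensor M G]. *)
Program Definition tensor_test (m : M V) (y : G V) : sheafify P V :=
  @shgen X P V (@tensor_test_rel m y) _ _ _.
Next Obligation. by move=> m y W r []. Qed.
Next Obligation.
move=> m y x Vx; have [_ qsurj _] := qP.
have [W [WV [i [u [Wx e]]]]] := qsurj V y x Vx.
by exists W, (tin (tpure (pres M WV m) u)); split=> //; exists WV, i, u.
Qed.
Next Obligation.
move=> m y W r W' r' x [WV [i [u [e ->]]]] [WV' [i' [u' [e' ->]]]] Wx W'x.
have [qmap _ qinj] := qP.
have [k [ik ik']] := d_directed i i'.
pose Z := opensI W W'.
have ZW : Z `<=` W by exact: opensIl.
have ZW' : Z `<=` W' by exact: opensIr.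
(* Both preimages of [y], moved to stage [k] and restricted to [Z], have the same image under [q k],
   so they agree near [x] at a later stage [l]. *)
pose d := ps_map D ik Z (pres _ ZW u) - ps_map D ik' Z (pres _ ZW' u').
have d0 : q k Z d = 0.
  rewrite pmorB !qmap !pmor_res e e'.
  rewrite (pres_comp WV ZW (subset_trans ZW WV)).
  by rewrite (pres_comp WV' ZW' (subset_trans ZW WV)) subrr.
have [Y [YZ [l [kl [Yx]]]]] := qinj _ _ _ x d0 (conj Wx W'x).
rewrite /d presB pmorB => /eqP; rewrite subr_eq0 -!pmor_res => /eqP ed.
exists Y, (subset_trans YZ ZW), (subset_trans YZ ZW'); split=> //.
rewrite !tin_res.
rewrite (pres_comp WV _ (subset_trans (subset_trans YZ ZW) WV)).
rewrite (pres_comp WV' _ (subset_trans (subset_trans YZ ZW) WV)).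
rewrite -(tin_map (dle_trans ik kl)) -[RHS](tin_map (dle_trans ik' kl)).
rewrite -!ps_mapA -(pres_comp ZW YZ) -(pres_comp ZW' YZ).
by rewrite ed.
Qed.

Lemma tensor_test_mem m y W (WV : W `<=` V) i (u : D i W) :
  q i W u = pres G WV y ->
  shmem (tensor_test m y) (tin (tpure (pres M WV m) u)).
Proof. by move=> e; apply: shgenW; exists WV, i, u. Qed.

Lemma local_lift2 (y y' : G V) x : oset V x ->
  exists W (WV : W `<=` V) i (u u' : D i W),
    [/\ oset W x, q i W u = pres G WV y & q i W u' = pres G WV y'].
Proof.
move=> Vx; have [qmap qsurj _] := qP.
have [W [WV [i [u [Wx e]]]]] := qsurj V y x Vx.
have [W' [WV' [i' [u' [W'x e']]]]] := qsurj W (pres G WV y') x Wx.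
have [k [ik ik']] := d_directed i i'.
exists W', (subset_trans WV' WV), k.
exists (ps_map D ik _ (pres _ WV' u)), (ps_map D ik' _ u').
by rewrite !qmap pmor_res -e -e' !(pres_comp _ _ (subset_trans WV' WV)).
Qed.

Lemma tinD i W (t t' : ptensor M (D i) W) : tin (t + t') = tin t + tin t'.
Proof. exact: cclassD. Qed.

Lemma tinZ i W a (t : ptensor M (D i) W) : tin (a *: t) = a *: tin t.
Proof. exact: cclassZ. Qed.

Lemma tensor_test_bilinear : is_bilinear tensor_test.
Proof.
split=> [m a y y' | y a m m'].
- apply: shsec_eq => x Vx.
  have [W [WV [i [u [u' [Wx e e']]]]]] := local_lift2 y y' Vx.
  exists W, (tin (tpure (pres M WV m) (ores WV a *: u + u'))); split=> //.
    by apply: tensor_test_mem; rewrite pmorD pmorZ e e' presD presZ.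
  rewrite (tpure_bilinear _ _).1 tinD tinZ.
  by apply: (@shmemD X P V); [apply: (@shmemZ X P V)|]; exact: tensor_test_mem.
- apply: shsec_eq => x Vx.
  have [W [WV [i [u [_ [Wx e _]]]]]] := local_lift2 y y Vx.
  exists W, (tin (tpure (pres M WV (a *: m + m')) u)); split=> //.
    exact: tensor_test_mem.
  rewrite presD presZ (tpure_bilinear _ _).2 tinD tinZ.
  by apply: (@shmemD X P V); [apply: (@shmemZ X P V)|]; exact: tensor_test_mem.
Qed.

(** A tensor that is 0 is killed by every bilinear map, in particular by [tensor_test]. Its value
    there is represented by the class of [tclass s], which is thus 0 near [x], and so 0 at a later
    stage. *)
Lemma tensor_local_colimit_inj i (s : seq (M V * D i V)) x :
  tclass [seq (a.1, q i V a.2) | a <- s] = 0 -> oset V x ->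
  exists W (WV : W `<=` V) j (ij : dle i j),
    oset W x /\ tclass [seq (pres M WV a.1, ps_map D ij W (pres _ WV a.2))
                       | a <- s] = 0.
Proof.
have VV := @subset_refl _ V.
move=> /(tclassP _ [::])/(_ _ tensor_test tensor_test_bilinear).
rewrite tsum0 /tsum big_map => e Vx.
have : shmem (\sum_(a <- s) tensor_test a.1 (q i V a.2)) (tin (tclass s)).
  elim: s {e} => [|[m u] s IH].
    have -> : tin (tclass [::]) = 0 by exact: (@cclass0 X I tensor_system).
    rewrite big_nil.
    exact: shmem0.
  rewrite big_cons -cat1s tclass_cat tinD; apply: (@shmemD X P V) => //.
  have -> : tclass [:: (m, u)] = tpure (pres M VV m) u by rewrite pres_id.
  by apply: tensor_test_mem; rewrite pres_id.
rewrite e => /(shmem_compat (shmem0 P VV))/(_ Vx Vx)[W [WV0 [WV [Wx]]]].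
rewrite pres0 => /esym; rewrite /tin /= colim_resE.
move=> /cclass_eq0[j [ij]] /=; 
rewrite ptensor_resE ptensor_morE.
by rewrite -map_comp => e0; exists W, WV, j, ij.
Qed.
End Test.
End TensorColimit.

(** * Purity *)

(** Injectivity is checked on germs: near each point a section of the kernel is represented by a
    presheaf section whose image vanishes there. *)
Lemma sheafify_mor_mono (X : ringed_space) (P Q : pmod X) (h : pmor P Q) :
  (forall (V : opens X) (t : P V) x, h V t = 0 -> oset V x ->
     exists (W : opens X) (WV : W `<=` V), oset W x /\ pres P WV t = 0) ->
  @mono_exact X (sheafify P) (sheafify Q) (sheafify_mor h).
Proof.
move=> hloc U s s' /eqP; rewrite -subr_eq0 -pmorB => /eqP.
set d := s - s' => hd0; apply/eqP; rewrite -subr_eq0 -/d; apply/eqP.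
apply: shsec_eq => x Ux.
have [V [t [dt Vx]]] := shmem_cover d Ux.
have VU := shmem_sub dt.
have := shmem_mor h dt; rewrite [sheafify_fun _ _]hd0.
move=> /(shmem_compat (shmem0 Q VU))/(_ Vx Vx)[W [WV' [WV [Wx]]]].
rewrite pres0 -pmor_res => /esym/hloc/(_ Wx)[Z [ZW [Zx e]]].
exists Z, 0; split=> //; last first.
  exact: shmem0 (subset_trans (subset_trans ZW WV) VU).
by rewrite -e; do 2 apply: (@shmem_pres X P U).
Qed.

(** An element of [ptensor M F] killed by [f] is viewed in [M (x) (F (+) D i0)] through [a] going to
    [(a, 0)]. Its image in [M (x) G] is 0, so it dies locally at a later stage [j]. *)
Lemma pure_mono_of_lifts (X : ringed_space) (F G T : omod X)
    (f : pmor F G) (g : pmor G T) (I : directed_set) (D : pmod_system X I)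
    (p : forall i, pmor (D i) T) (s : forall i, pmor (D i) G) :
  mono_exact f -> middle_exact f g -> is_local_colimit p ->
  (forall i (U : opens X) t, g U (s i U t) = p i U t) -> pure_mono f.
Proof.
move=> f_mono fg_exact pP gs M; apply: sheafify_mor_mono => V t x.
elim/tensorW: t => l /= + Vx; rewrite ptensor_morE => fl0.
have [i0] := d_inhabited I.
have := split_system_local_colimit f_mono fg_exact pP gs.
move=> /tensor_local_colimit_inj locinj.
have [|W [WV [j [ij [Wx e]]]]] :=
    locinj M V i0 [seq (a.1, (a.2, 0) : psum F (D i0) V) | a <- l] x _ Vx.
  rewrite -map_comp -fl0; congr tclass; apply: eq_map => a /=.
  by rewrite pmor0 addr0.
exists W, WV; split=> //; rewrite ptensor_resE.
(* The transition maps fix [(a, 0)], so the projection to [F], which splits the inclusion, recovers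
   the original element. *)
have /(congr1 (ptensor_mor M (psum_fst F (D j)) W)) := e.
rewrite pmor0 [LHS]ptensor_morE -!map_comp => <-; congr tclass.
by apply: eq_map => a /=; rewrite pres0 pmor0 addr0.
Qed.

Theorem proposition3p9 (X : scheme)
    (X_lfp : locally_finitely_presented (Qcoh X)) (E : short_exact X) :
  Pure_fp E -> Pure E.
Proof.
move=> E_fp; have [_ _ _ lfp] := X_lfp.
have [I [D [c [Dfp climit]]]] := lfp (se_T E).
(* The last clause of [Pure_fp], at the finitely presented [D i], lifts [c i]; the lifts are chosen
   independently of each other. *)
have /all_sig[s sP] i :
    {u : hom (D i) (se_G E) | hom_post (D i) (se_g E) u = c i}.
  by apply: cid; have [_ _ ] := E_fp _ (Dfp i); apply.
apply: (@pure_mono_of_lifts X _ _ _ (se_f E) (se_g E) I (qcoh_system D) _ s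
  (@se_mono _ E) (@se_middle _ E) (qcoh_direct_limit_local climit)) => i U t.
exact: (congr1 (fun k : pmor _ _ => k U t) (sP i)).
Qed.
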